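(* Let $n,m,r,p$ be positive integers with $p\geq r$ and $\frac{p(p+1)}{2}+pr\leq m$. Let $\mathcal{A}:\mathbb{S}^{n\times n}\to\mathbb{R}^m$ be a linear map and $b\in\mathbb{R}^m$. Assume that (1) $\mathcal{C}=\{X\in\mathbb{S}^{n\times n}:\mathcal{A}(X)=b,X\succeq0\}$ has at least one extreme point with rank $r$, denoted by $X_0$; (2) $(\mathcal{A},b)$ is $p$-regular; (3) there exists $V\in\mathcal{M}_p$ such that $\mathcal{M}_p$ is $X_0$-minimally secant at $V$. Then there exists a subset $\mathcal{E}_{bad}$ of $\mathbb{S}^{n\times n}$ with non-zero Lebesgue measure such that, for any cost matrix $C\in\mathcal{E}_{bad}$, - the problem (SDP) with cost matrix $C$ has a unique global minimizer, which has rank $r$; - the problem (Factorized SDP) with cost matrix $C$ has at least one second-order critical point that is not a global minimizer.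
   Context: $\mathbb{S}^{n\times n}$ is the space of real symmetric $n\times n$ matrices; $\langle M_1,M_2\rangle=\mathrm{Tr}(M_1^TM_2)$; $\mathrm{Anti}(p)$ is the set of antisymmetric real $p\times p$ matrices. For a cost matrix $C\in\mathbb{S}^{n\times n}$: (SDP): minimize $\langle C,X\rangle$ over $X\in\mathcal{C}$. (Factorized SDP): minimize $f_C(V)=\langle C,VV^T\rangle$ over $V\in\mathcal{M}_p=\{V\in\mathbb{R}^{n\times p}:\mathcal{A}(VV^T)=b\}$. $(\mathcal{A},b)$ is $p$-regular if for all $V\in\mathcal{M}_p$ the linear map $\dot V\in\mathbb{R}^{n\times p}\mapsto\mathcal{A}(V\dot V^T+\dot VV^T)\in\mathbb{R}^m$ is surjective. In that case $\mathcal{M}_p$ is a submanifold of $\mathbb{R}^{n\times p}$ of dimension $np-m$, with tangent space $T_V\mathcal{M}_p=\{\dot V\in\mathbb{R}^{n\times p}:\mathcal{A}(V\dot V^T+\dot VV^T)=0\}$, equipped with the Riemannian metric induced by $\langle\cdot,\cdot\rangle$. $V\in\mathcal{M}_p$ is a second-order critical point of (Factorized SDP) if the Riemannian gradient and Hessian of $f_C:\mathcal{M}_p\to\mathbb{R}$ satisfy $\nabla f_C(V)=0$ and $\mathrm{Hess}f_C(V)\succeq0$. For a rank $r$ matrix $X_0\in\mathcal{C}$ and $V\in\mathcal{M}_p$, $\mathcal{M}_p$ is $X_0$-minimally secant at $V$ if: (i) $\mathrm{rank}(V)=p$; (ii) $\mathrm{Range}(X_0)\cap\mathrm{Range}(V)=\{0\}$;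 (iii) for any $\dot V\in T_V\mathcal{M}_p$, if $\mathrm{Range}(\dot V)\subset\mathrm{Range}(X_0)+\mathrm{Range}(V)$, then $\dot V=VA$ for some $A\in\mathrm{Anti}(p)$. *)

(* Defs.v *)
From HB Require Import structures.
From mathcomp Require Import all_boot all_order all_algebra.
From mathcomp Require Import all_classical all_reals all_analysis.

Set Implicit Arguments.
Unset Strict Implicit.
Unset Printing Implicit Defensive.

Import Order.TTheory GRing.Theory Num.Theory.
Import numFieldNormedType.Exports.

Local Open Scope classical_set_scope.
Local Open Scope ring_scope.

(* The library provides the predicates symmetricmx and skewmx, but no vector
   space of symmetric matrices: symmx R n is the subtype, with the lmodType
   structure inherited from 'M[R]_n. *)
Section SymmetricMatrices.
Variables (R : realType) (n : nat).

Lemma symmetricmxE (M : 'M[R]_n) : (M \is symmetricmx) = (M == M^T).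
Proof. by rewrite is_hermitianmxE expr0 scale1r map_mx_id. Qed.

Lemma symmetricmx_submod_closed :
  submod_closed (symmetricmx : qualifier 0 'M[R]_n).
Proof.
split=> [|a M N]; rewrite !symmetricmxE ?trmx0 //.
by move=> /eqP MT /eqP NT; rewrite linearP /= -MT -NT.
Qed.

HB.instance Definition _ :=
  GRing.isSubmodClosed.Build R 'M[R]_n
    (has_quality 0 (symmetricmx : qualifier 0 'M[R]_n))
    symmetricmx_submod_closed.

Record symmx := SymMx { symmx_val :> 'M[R]_n; _ : symmx_val \is symmetricmx }.

HB.instance Definition _ := [isSub for symmx_val].
HB.instance Definition _ := [Choice of symmx by <:].
HB.instance Definition _ := [SubChoice_isSubLmodule of symmx by <:].

End SymmetricMatrices.

Lemma gram_subproof (R : realType) (n p : nat) (V : 'M[R]_(n, p)) :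
  V *m V^T \is symmetricmx.
Proof. by rewrite symmetricmxE trmx_mul trmxK. Qed.

Definition gram (R : realType) (n p : nat) (V : 'M[R]_(n, p)) : symmx R n :=
  SymMx (gram_subproof V).

Lemma dgram_subproof (R : realType) (n p : nat) (V W : 'M[R]_(n, p)) :
  V *m W^T + W *m V^T \is symmetricmx.
Proof. by rewrite symmetricmxE linearD /= !trmx_mul !trmxK addrC. Qed.

Definition dgram (R : realType) (n p : nat) (V W : 'M[R]_(n, p)) : symmx R n :=
  SymMx (dgram_subproof V W).

Definition mxdot (R : realType) (n p : nat) (M N : 'M[R]_(n, p)) : R :=
  \tr (M^T *m N).

Definition psdmx (R : realType) (n : nat) (M : 'M[R]_n) : Prop :=
  forall x : 'cV[R]_n, 0 <= (x^T *m M *m x) 0 0.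

Definition extreme_point (R : realType) (E : lmodType R) (S : set E) (x : E) :
  Prop :=
  S x /\
  forall (y z : E) (t : R), S y -> S z -> 0 < t -> t < 1 ->
    x = t *: y + (1 - t) *: z -> y = x /\ z = x.

Definition global_minimizer (R : realType) (T : Type) (S : set T) (f : T -> R)
  (x : T) : Prop :=
  S x /\ forall y, S y -> f x <= f y.

(* Lebesgue measure on symmetric matrices, in the n(n+1)/2 coordinates M i j
   with i <= j. The value differs from the one given by the trace inner product
   by the factor 2^(n(n-1)/4), so both have the same null sets. *)
Definition symmx_box (R : realType) (n : nat) (B : 'M[R]_n * 'M[R]_n) :
  set (symmx R n) :=
  [set M : symmx R n |
    forall i j : 'I_n, (i <= j)%N -> B.1 i j <= M i j <= B.2 i j].

Definition symmx_box_volume (R : realType) (n : nat) (B : 'M[R]_n * 'M[R]_n) :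
  R :=
  \prod_(i < n) \prod_(j < n | (i <= j)%N) Num.max 0 (B.2 i j - B.1 i j).

Definition symmx_lebesgue (R : realType) (n : nat) (E : set (symmx R n)) :
  \bar R :=
  ereal_inf [set (\sum_(0 <= k <oo) (symmx_box_volume (B k))%:E)%E |
    B in [set B : nat -> 'M[R]_n * 'M[R]_n |
      E `<=` \bigcup_k symmx_box (B k)]].

Definition symmx_lebesgue_measurable (R : realType) (n : nat)
  (E : set (symmx R n)) : Prop :=
  (@symmx_lebesgue R n).-caratheodory E.

Section Problems.
Variables (R : realType) (n m : nat).
Variables (A : {linear symmx R n -> 'cV[R]_m}) (b : 'cV[R]_m).

Definition sdp_feasible : set (symmx R n) :=
  [set X : symmx R n | A X = b /\ psdmx X].

Definition factor_manifold (p : nat) : set 'M[R]_(n, p) :=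
  [set V | A (gram V) = b].

Definition p_regular (p : nat) : Prop :=
  forall V : 'M[R]_(n, p), factor_manifold V ->
    forall y : 'cV[R]_m, exists W : 'M[R]_(n, p), A (dgram V W) = y.

Definition tangent_space (p : nat) (V : 'M[R]_(n, p)) : set 'M[R]_(n, p) :=
  [set W | A (dgram V W) = 0].

(* Ranges are column spaces, hence the transposes. *)
Definition minimally_secant (p : nat) (X0 : symmx R n) (V : 'M[R]_(n, p)) :
  Prop :=
  [/\ \rank V = p,
      ((X0 : 'M[R]_n)^T :&: V^T)%MS = 0
    & forall W : 'M[R]_(n, p), tangent_space V W ->
        (W^T <= (X0 : 'M[R]_n)^T + V^T)%MS ->
        exists2 S : 'M[R]_p, S \is skewmx & W = V *m S].

Definition tangent_proj (p : nat) (V Z : 'M[R]_(n, p)) : 'M[R]_(n, p) :=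
  xget 0 [set P | tangent_space V P /\
    forall W, tangent_space V W -> mxdot (Z - P) W = 0].

(* Gradient of the restriction to the manifold of a function f defined on the
   whole of R^(n x p), for the metric induced by mxdot. Under p-regularity the
   constraint map stays a submersion near the manifold, so this formula also
   defines a smooth extension of the gradient field to a neighbourhood. *)
Definition riemannian_gradient (p : nat) (f : 'M[R]_(n, p) -> R)
  (V : 'M[R]_(n, p)) : 'M[R]_(n, p) :=
  xget 0 [set G | tangent_space V G /\
    forall W, tangent_space V W -> mxdot G W = 'D_W f V].

(* Covariant derivative of the gradient field: the Levi-Civita connection of the
   induced metric is the tangential part of the ambient derivative. For W tangent
   at V the result does not depend on the extension of the field. *)
Definition riemannian_hessian (p : nat) (f : 'M[R]_(n, p) -> R)
  (V W : 'M[R]_(n, p)) : 'M[R]_(n, p) :=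
  tangent_proj V ('D_W (riemannian_gradient f) V).

Definition second_order_critical (p : nat) (f : 'M[R]_(n, p) -> R)
  (V : 'M[R]_(n, p)) : Prop :=
  [/\ factor_manifold V,
      riemannian_gradient f V = 0
    & forall W, tangent_space V W -> 0 <= mxdot W (riemannian_hessian f V W)].

End Problems.

Definition sdp_cost (R : realType) (n : nat) (C X : symmx R n) : R :=
  mxdot (C : 'M[R]_n) X.

Definition factor_cost (R : realType) (n p : nat) (C : symmx R n)
  (V : 'M[R]_(n, p)) : R :=
  mxdot (C : 'M[R]_n) (V *m V^T).

(* Main.v *)
From HB Require Import structures.
Require Import Defs.
From mathcomp Require Import all_boot all_order all_algebra.
From mathcomp Require Import all_classical all_reals all_analysis.
From mathcomp Require measurable_realfun.
From mathcomp Require Import ring lra.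

(** Write [A*] for the adjoint of [A] and [N = A* nu] for a symmetric matrix in
its range.  The bad costs surround one explicit matrix

  S0 = (N V) (N V)^T + K Y^T Y,

where the kernel of [Y] is Range X0 + Range V, and [nu] satisfies V^T N V = I
and V^T N X0 = 0.  Such a [nu] exists by the Fredholm alternative: an
annihilator of the range of nu |-> (V^T N V, V^T N X0) yields a tangent
direction inside Range X0 + Range V, and minimal secancy leaves only the
infinitesimal rotations V T, T skew ([dual_certificate]).

Seen from X0, the cost S0 is positive semidefinite with kernel Range X0, so
that 0 is a multiplier at X0 and strict complementarity holds; by extremality
X0 is then the only minimizer of the SDP, with quadratic growth
([growth_at_extreme_point]).  Seen from V, S0 V = N V, so that nu is a multiplier
at V for the factorized problem, and <S0, W W^T - V V^T> = <S0 - N, W W^T> on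
the feasible factors W.  Minimal secancy makes every tangent direction that is
not an infinitesimal rotation leave Range X0 + Range V, so that it is seen by
Y; once K is large, V V^T is a strict local minimizer with quadratic growth in
W W^T - V V^T ([growth_at_factor]).  As <S0, V V^T> > 0 = <S0, X0>, V is not a
global minimizer.

All this survives a small perturbation of the cost, without any implicit
function theorem.  Quadratic growth and compactness give, for every cost near
S0, a minimizer of the SDP near X0 and a local minimizer of the factorized
problem near V V^T ([perturbed_growth]).  Local minimizers on the constraint
set satisfy the first- and second-order conditions
([second_order_conditions]); this rests on feasible curves with prescribed
velocity, obtained from Banach's fixed point theorem ([feasible_curve]).  For
the SDP, a factorization X = F F^T yields a multiplier close to the one at X0,
and lower semicontinuity of the rank, applied to the solution and to its dual
slack matrix, forces the rank to stay equal to r, while nondegeneracy gives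
uniqueness ([sdp_stable]).  The multiplier conditions are those of a
second-order critical point because the projection onto the tangent space is
differentiable along lines ([second_order_critical_of_multiplier]).

The bad set is a closed box around S0.  It is Caratheodory measurable because
half-spaces cut boxes into boxes ([box_measurable]), and has positive measure
by integrating the indicator functions of a covering one coordinate at a time
([leb_box_gt0]).

Sizes are measured by the squared Frobenius norm [sqn], which keeps the
estimates polynomial; linear algebra replaces compactness in them, since an
injective linear map between matrix spaces has a linear left inverse. *)

Set Implicit Arguments.
Unset Strict Implicit.
Unset Printing Implicit Defensive.

Import Order.TTheory GRing.Theory Num.Theory.
Import numFieldNormedType.Exports.
Local Open Scope classical_set_scope.
Local Open Scope ring_scope.

(** * The Frobenius inner product and the squared norm *)

Section Mxdot.
Variable R : realType.
Implicit Types k l q : nat.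

Lemma mxdotE k l (M N : 'M[R]_(k, l)) :
  mxdot M N = \sum_i \sum_j M i j * N i j.
Proof.
rewrite /mxdot /mxtrace exchange_big /=; apply: eq_bigr => j _.
by rewrite mxE; apply: eq_bigr => i _; rewrite mxE.
Qed.

Lemma mxdotC k l (M N : 'M[R]_(k, l)) : mxdot M N = mxdot N M.
Proof.
by rewrite !mxdotE; do 2!apply: eq_bigr => ? _; rewrite mulrC.
Qed.

Lemma mxdot_is_linear k l (M : 'M[R]_(k, l)) :
  linear (mxdot M : 'M[R]_(k, l) -> R^o).
Proof. by move=> c x y; rewrite /mxdot mulmxDr -scalemxAr linearP. Qed.

HB.instance Definition _ k l (M : 'M[R]_(k, l)) :=
  GRing.isLinear.Build R 'M[R]_(k, l) R^o _ (mxdot M) (@mxdot_is_linear k l M).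

Lemma mxdotDr k l (M x y : 'M[R]_(k, l)) :
  mxdot M (x + y) = mxdot M x + mxdot M y.
Proof. exact: linearD. Qed.
Lemma mxdotBr k l (M x y : 'M[R]_(k, l)) :
  mxdot M (x - y) = mxdot M x - mxdot M y.
Proof. exact: linearB. Qed.
Lemma mxdotNr k l (M x : 'M[R]_(k, l)) : mxdot M (- x) = - mxdot M x.
Proof. exact: linearN. Qed.
Lemma mxdotZr k l c (M x : 'M[R]_(k, l)) : mxdot M (c *: x) = c * mxdot M x.
Proof. exact: linearZ. Qed.
Lemma mxdot0r k l (M : 'M[R]_(k, l)) : mxdot M 0 = 0.
Proof. exact: linear0. Qed.
Lemma mxdotDl k l (M x y : 'M[R]_(k, l)) :
  mxdot (x + y) M = mxdot x M + mxdot y M.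
Proof. by rewrite !(mxdotC _ M) mxdotDr. Qed.
Lemma mxdotBl k l (M x y : 'M[R]_(k, l)) :
  mxdot (x - y) M = mxdot x M - mxdot y M.
Proof. by rewrite !(mxdotC _ M) mxdotBr. Qed.
Lemma mxdotNl k l (M x : 'M[R]_(k, l)) : mxdot (- x) M = - mxdot x M.
Proof. by rewrite !(mxdotC _ M) mxdotNr. Qed.
Lemma mxdotZl k l c (M x : 'M[R]_(k, l)) : mxdot (c *: x) M = c * mxdot x M.
Proof. by rewrite !(mxdotC _ M) mxdotZr. Qed.
Lemma mxdot0l k l (M : 'M[R]_(k, l)) : mxdot 0 M = 0.
Proof. by rewrite mxdotC mxdot0r. Qed.

Definition mxdotlin := (mxdotDr, mxdotBr, mxdotNr, mxdotZr, mxdot0r,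
  mxdotDl, mxdotBl, mxdotNl, mxdotZl, mxdot0l).

Lemma mxdot_tr k l (M N : 'M[R]_(k, l)) : mxdot M^T N^T = mxdot M N.
Proof. by rewrite /mxdot -mxtrace_tr trmx_mul !trmxK mxtrace_mulC. Qed.

Lemma mxdot_mull k l q (B : 'M[R]_(k, l)) (M : 'M[R]_(l, q)) (N : 'M[R]_(k, q)) :
  mxdot (B *m M) N = mxdot M (B^T *m N).
Proof. by rewrite /mxdot trmx_mul mulmxA. Qed.

Lemma mxdot_mulr k l q (B : 'M[R]_(l, q)) (M : 'M[R]_(k, l)) (N : 'M[R]_(k, q)) :
  mxdot (M *m B) N = mxdot M (N *m B^T).
Proof. by rewrite -mxdot_tr trmx_mul mxdot_mull -mxdot_tr trmx_mul !trmxK. Qed.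

Definition sqn k l (M : 'M[R]_(k, l)) : R := mxdot M M.

Lemma sqn_ge0 k l (M : 'M[R]_(k, l)) : 0 <= sqn M.
Proof.
rewrite /sqn mxdotE; apply: sumr_ge0 => i _; apply: sumr_ge0 => j _.
by rewrite -expr2 sqr_ge0.
Qed.

Lemma sqn_coord k l (M : 'M[R]_(k, l)) i j : M i j ^+ 2 <= sqn M.
Proof.
rewrite /sqn mxdotE (bigD1 i) //= (bigD1 j) //= -expr2 -addrA lerDl.
rewrite addr_ge0 ?sumr_ge0 // => [h _|h _]; rewrite ?sumr_ge0 // -?expr2 ?sqr_ge0 //.
by move=> ? _; rewrite -expr2 sqr_ge0.
Qed.

Lemma sqn_le0 k l (M : 'M[R]_(k, l)) : sqn M <= 0 -> M = 0.
Proof.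
move=> h; apply/matrixP => i j; rewrite mxE; apply/eqP.
by rewrite -sqrf_eq0 eq_le sqr_ge0 andbT (le_trans (sqn_coord M i j)).
Qed.

Lemma sqn0 k l : sqn (0 : 'M[R]_(k, l)) = 0.
Proof. exact: mxdot0r. Qed.

Lemma sqnN k l (M : 'M[R]_(k, l)) : sqn (- M) = sqn M.
Proof. by rewrite /sqn !mxdotlin opprK. Qed.

Lemma sqnZ k l c (M : 'M[R]_(k, l)) : sqn (c *: M) = c ^+ 2 * sqn M.
Proof. by rewrite /sqn !mxdotlin mulrA. Qed.

Lemma sqn_tr k l (M : 'M[R]_(k, l)) : sqn M^T = sqn M.
Proof. exact: mxdot_tr. Qed.

Lemma sqnD k l (M N : 'M[R]_(k, l)) : sqn (M + N) <= 2 * sqn M + 2 * sqn N.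
Proof.
have := sqn_ge0 (M - N); rewrite /sqn !mxdotlin (mxdotC N M); lra.
Qed.

Lemma sqnB k l (M N : 'M[R]_(k, l)) : sqn (M - N) <= 2 * sqn M + 2 * sqn N.
Proof. by have := sqnD M (- N); rewrite sqnN. Qed.

Lemma mxdot_CS k l (M N : 'M[R]_(k, l)) : mxdot M N ^+ 2 <= sqn M * sqn N.
Proof.
have [N0|N0] := leP (sqn N) 0.
  by rewrite (sqn_le0 N0) mxdot0r sqn0 expr0n mulr0.
have := sqn_ge0 (sqn N *: M - mxdot M N *: N).
rewrite {1}/sqn !mxdotlin (mxdotC N M) -/(sqn M) -/(sqn N).
rewrite [X in 0 <= X -> _](_ : _ = sqn N * (sqn M * sqn N - mxdot M N ^+ 2)); last by ring.
by rewrite pmulr_rge0 // subr_ge0.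
Qed.

(** The Cauchy-Schwarz bound in the form used with squared norms: it gives
|<M, N>| <= s without square roots. *)
Lemma mxdot_le k l (M N : 'M[R]_(k, l)) s :
  0 <= s -> sqn M * sqn N <= s ^+ 2 -> `|mxdot M N| <= s.
Proof.
move=> s0 h; rewrite -(ler_sqr (x := `|_|)) ?nnegrE // real_normK ?num_real //.
exact: le_trans (mxdot_CS M N) h.
Qed.

Lemma mxdot_AMGM k l (M N : 'M[R]_(k, l)) : 2 * `|mxdot M N| <= sqn M + sqn N.
Proof.
have := sqn_ge0 (M - N); have := sqn_ge0 (M + N).
rewrite /sqn !mxdotlin (mxdotC N M) => h1 h2.
by rewrite -ler_pdivlMl // ler_norml; apply/andP; split; lra.
Qed.

Lemma sqnM k l q (M : 'M[R]_(k, l)) (N : 'M[R]_(l, q)) :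
  sqn (M *m N) <= sqn M * sqn N.
Proof.
have rowE : sqn M = \sum_i sqn (row i M).
  by rewrite /sqn mxdotE; apply: eq_bigr => i _; rewrite mxdotE big_ord1;
     apply: eq_bigr => j _; rewrite !mxE.
have colE : sqn N = \sum_j sqn (col j N)^T.
  rewrite /sqn mxdotE exchange_big; apply: eq_bigr => i _; rewrite mxdotE big_ord1.
  by apply: eq_bigr => j _; rewrite !mxE.
rewrite rowE mulr_suml {1}/sqn mxdotE; apply: ler_sum => i _.
rewrite colE mulr_sumr; apply: ler_sum => j _.
apply: le_trans (mxdot_CS _ _); rewrite expr2 le_eqVlt; apply/orP; left; apply/eqP.
by congr (_ * _); rewrite mxE mxdotE big_ord1; apply: eq_bigr => h _; rewrite !mxE.
Qed.

Lemma sqn_gram k l (M : 'M[R]_(k, l)) : sqn (M *m M^T) <= sqn M ^+ 2.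
Proof. by rewrite expr2 -{2}(sqn_tr M) sqnM. Qed.

(** The trace of a Gram matrix is a squared norm; this is how bounds on W W^T
bound W. *)
Lemma mxtrace_gram k l (M : 'M[R]_(k, l)) : mxdot 1%:M (M *m M^T) = sqn M.
Proof. by rewrite -mxdot_mulr mul1mx. Qed.

Lemma sqn_row_mx k l q (M : 'M[R]_(k, l)) (N : 'M[R]_(k, q)) :
  sqn (row_mx M N) = sqn M + sqn N.
Proof.
rewrite /sqn !mxdotE -big_split; apply: eq_bigr => i _ /=.
by rewrite big_split_ord /=; congr (_ + _); apply: eq_bigr => j _;
  rewrite ?row_mxEl ?row_mxEr.
Qed.

Lemma mxdot_mxvec k l (M N : 'M[R]_(k, l)) : mxdot (mxvec M) (mxvec N) = mxdot M N.
Proof.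
rewrite !mxdotE big_ord1 (reindex _ (curry_mxvec_bij _ _)) /=.
rewrite pair_bigA /=; apply: eq_bigr => -[i j] _ /=.
by rewrite !mxvecE.
Qed.

Lemma sqn_mxvec k l (M : 'M[R]_(k, l)) : sqn (mxvec M) = sqn M.
Proof. exact: mxdot_mxvec. Qed.

End Mxdot.

(** * Linear maps between matrix spaces *)

Section LinearBounds.
Variable R : realType.

(** Lets the theory of bundled linear maps apply to functions that are only
known to satisfy [linear]. *)
Definition mklin (U V : lmodType R) (f : U -> V) (lf : linear f) :
  {linear U -> V} := HB.pack f (GRing.isLinear.Build R U V _ f lf).

Lemma lin_bound k l s t (f : 'M[R]_(k, l) -> 'M[R]_(s, t)) : linear f ->
  exists2 c, 0 <= c & forall x, sqn (f x) <= c * sqn x.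
Proof.
move=> lf; exists (sqn (lin_mx (mklin lf))); first exact: sqn_ge0.
move=> x; have /(congr1 (@sqn R _ _)) := mul_vec_lin (mklin lf) x.
by rewrite sqn_mxvec /= => <-; rewrite mulrC -(sqn_mxvec x) sqnM.
Qed.

(** A jointly injective family has a linear left inverse, and linear maps are
bounded.  Three maps serve a constraint, a symmetry condition and one more
map. *)
Lemma lin_inj_bound k l s1 t1 s2 t2 s3 t3
    (f : 'M[R]_(k, l) -> 'M[R]_(s1, t1)) (g : 'M[R]_(k, l) -> 'M[R]_(s2, t2))
    (h : 'M[R]_(k, l) -> 'M[R]_(s3, t3)) :
  linear f -> linear g -> linear h ->
  (forall x, f x = 0 -> g x = 0 -> h x = 0 -> x = 0) ->
  exists2 c, 0 <= c & forall x, sqn x <= c * (sqn (f x) + sqn (g x) + sqn (h x)).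
Proof.
move=> lf lg lh inj.
pose G := row_mx (row_mx (lin_mx (mklin lf)) (lin_mx (mklin lg))) (lin_mx (mklin lh)).
have GE x : mxvec x *m G = row_mx (row_mx (mxvec (f x)) (mxvec (g x))) (mxvec (h x)).
  by rewrite !mul_mx_row !mul_vec_lin.
have rfG : row_free G.
  apply: inj_row_free => v; rewrite -(vec_mxK v) GE -!(row_mx0, linear0) => /eq_row_mx[].
  move=> /eq_row_mx[f0 g0 h0]; suff -> : vec_mx v = 0 by rewrite linear0.
  by apply: inj; apply: (can_inj mxvecK); rewrite ?f0 ?g0 ?h0 !linear0.
exists (sqn (pinvmx G)); first exact: sqn_ge0.
move=> x; rewrite -{1}(sqn_mxvec x) -(mulmxKp rfG (mxvec x)) GE mulrC.
by apply: le_trans (sqnM _ _) _; rewrite !sqn_row_mx !sqn_mxvec.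
Qed.

Lemma lin_inj_bound1 k l s t (f : 'M[R]_(k, l) -> 'M[R]_(s, t)) :
  linear f -> (forall x, f x = 0 -> x = 0) ->
  exists2 c, 0 <= c & forall x, sqn x <= c * sqn (f x).
Proof.
move=> lf inj; have l0 : linear (fun _ : 'M[R]_(k, l) => 0 : 'M[R]_(0, 0)).
  by move=> ? ? ?; rewrite scaler0 addr0.
have [|c c0 h] := lin_inj_bound lf l0 l0; first by move=> x /inj.
by exists c => // x; have := h x; rewrite sqn0 !addr0.
Qed.

Lemma lin_right_inverse k l s t (f : 'M[R]_(k, l) -> 'M[R]_(s, t)) :
  linear f -> (forall y, exists x, f x = y) ->
  exists g : {linear 'M[R]_(s, t) -> 'M[R]_(k, l)}, forall y, f (g y) = y.
Proof.
move=> lf sf; pose B := lin_mx (mklin lf).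
have rfB : row_full B.
  rewrite -sub1mx; apply/row_subP => i.
  have [x fx] := sf (vec_mx (row i 1%:M)).
  apply/submxP; exists (mxvec x); rewrite mul_vec_lin /= fx vec_mxK.
  by [].
have lg : linear (fun y : 'M[R]_(s, t) => vec_mx (mxvec y *m pinvmx B) : 'M[R]_(k, l)).
  by move=> c x y; rewrite linearP /= mulmxDl -scalemxAl linearP.
exists (mklin lg) => y /=; apply: (can_inj mxvecK).
by rewrite -[f _]/(mklin lf _) -mul_vec_lin vec_mxK -mulmxA mulVpmx // mulmx1.
Qed.

Lemma lin_inj_surj k l (f : 'M[R]_(k, l) -> 'M[R]_(k, l)) :
  linear f -> (forall x, f x = 0 -> x = 0) -> forall y, exists x, f x = y.
Proof.
move=> lf inj y; pose B := lin_mx (mklin lf).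
have rfB : row_free B.
  apply: inj_row_free => v; rewrite -(vec_mxK v) mul_vec_lin => /= h.
  suff -> : vec_mx v = 0 by rewrite linear0.
  apply: inj; apply: (can_inj mxvecK).
  by rewrite h linear0.
exists (vec_mx (mxvec y *m invmx B)); apply: (can_inj mxvecK).
rewrite -[f _]/(mklin lf _) -mul_vec_lin vec_mxK mulmxKV //.
by rewrite -row_free_unit.
Qed.

(** The Fredholm alternative. *)
Lemma lin_solvable k l s t (f : 'M[R]_(k, l) -> 'M[R]_(s, t)) y : linear f ->
  (forall z, (forall x, mxdot z (f x) = 0) -> mxdot z y = 0) -> exists x, f x = y.
Proof.
move=> lf ort; pose B := lin_mx (mklin lf).
have dotE (z w : 'M[R]_(s, t)) : mxvec w *m (mxvec z)^T = (mxdot z w)%:M.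
  by rewrite [LHS]mx11_scalar -mxdot_mxvec mxdotC -mxdot_tr /mxdot trace_mx11 trmxK.
suff /submxP[u yu] : (mxvec y <= B)%MS.
  exists (vec_mx u); apply: (can_inj mxvecK).
  by rewrite -[f _]/(mklin lf _) -mul_vec_lin vec_mxK.
rewrite submxE; apply/eqP/matrixP => i j; rewrite [RHS]mxE ord1.
pose z : 'M[R]_(s, t) := vec_mx (col j (cokermx B))^T.
have zE : (mxvec z)^T = col j (cokermx B) by rewrite vec_mxK trmxK.
have <- : (mxvec y *m col j (cokermx B)) 0 0 = (mxvec y *m cokermx B) 0 j.
  by rewrite colE mulmxA -colE mxE.
rewrite -zE dotE mxE mulr1n; apply: ort => x.
have := dotE z (f x); rewrite zE -[f x]/(mklin lf x) -mul_vec_lin -mulmxA.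
rewrite colE (mulmxA B) mulmx_coker mul0mx mulmx0 => /matrixP/(_ 0 0).
by rewrite !mxE.
Qed.

End LinearBounds.

(** * Continuity and minimization over compact sets of matrices *)

Section Continuity.
Variable R : realType.

(** Entrywise continuity, which is closed under the matrix operations by the
corresponding facts on real functions. *)
Definition mxcts (T : topologicalType) k l (F : T -> 'M[R]_(k, l)) :=
  forall i j, continuous (fun x => F x i j : R^o).

Lemma continuous_sum_ord (T : topologicalType) n (F : 'I_n -> T -> R) :
  (forall i, continuous (F i)) -> continuous (fun x => \sum_i F i x).
Proof.
elim: n F => [|n IH] F cF x.
  rewrite (_ : (fun x => _) = fun=> 0); first exact: cvg_cst.
  by apply/funext => y; rewrite big_ord0.
rewrite (_ : (fun x => _) = fun x => F ord0 x + \sum_(i < n) F (lift ord0 i) x).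
  by apply: (@cvgD _ R^o); [exact: cF | apply: IH => i; exact: cF].
by apply/funext => y; rewrite big_ord_recl.
Qed.

Lemma mxcts_id k l : mxcts (fun M : 'M[R]_(k, l) => M).
Proof. by move=> i j; exact: coord_continuous. Qed.

Variable T : topologicalType.
Implicit Types k l q : nat.

Lemma mxcts_cst k l (M : 'M[R]_(k, l)) : mxcts (fun _ : T => M).
Proof. by move=> i j x; exact: cvg_cst. Qed.

Lemma mxctsD k l (F G : T -> 'M[R]_(k, l)) :
  mxcts F -> mxcts G -> mxcts (fun x => F x + G x).
Proof.
move=> cF cG i j x; under eq_fun do rewrite mxE.
by apply: (@cvgD _ R^o); [exact: cF | exact: cG].
Qed.

Lemma mxctsN k l (F : T -> 'M[R]_(k, l)) : mxcts F -> mxcts (fun x => - F x).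
Proof.
move=> cF i j x; under eq_fun do rewrite mxE.
by apply: (@cvgN _ R^o); exact: cF.
Qed.

Lemma mxcts_tr k l (F : T -> 'M[R]_(k, l)) : mxcts F -> mxcts (fun x => (F x)^T).
Proof.
by move=> cF i j x; under eq_fun do rewrite mxE; exact: cF.
Qed.

Lemma mxctsM k l q (F : T -> 'M[R]_(k, l)) (G : T -> 'M[R]_(l, q)) :
  mxcts F -> mxcts G -> mxcts (fun x => F x *m G x).
Proof.
move=> cF cG i j; under eq_fun do rewrite mxE.
by apply: continuous_sum_ord => h x; apply: cvgM; [exact: cF | exact: cG].
Qed.

Lemma mxcts_dot k l (F G : T -> 'M[R]_(k, l)) :
  mxcts F -> mxcts G -> continuous (fun x => mxdot (F x) (G x)).
Proof.
move=> cF cG; under eq_fun do rewrite mxdotE.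
apply: continuous_sum_ord => i; apply: continuous_sum_ord => j x.
by apply: cvgM; [exact: cF | exact: cG].
Qed.

Lemma mxcts_sqnB k l (F : T -> 'M[R]_(k, l)) c :
  mxcts F -> continuous (fun x => sqn (F x) - c).
Proof.
move=> cF x; apply: (@cvgD _ R^o); last exact: cvg_cst.
exact: (mxcts_dot cF cF).
Qed.

Lemma mxcts_lin k l s t (f : 'M[R]_(k, l) -> 'M[R]_(s, t)) (F : T -> 'M[R]_(k, l)) :
  linear f -> mxcts F -> mxcts (fun x => f (F x)).
Proof.
move=> lf cF i j.
have fE x : f (F x) i j = \sum_a \sum_b F x a b * f (delta_mx a b) i j.
  rewrite {1}[F x]matrix_sum_delta -[f _]/(mklin lf _) linear_sum summxE.
  apply: eq_bigr => a _; rewrite linear_sum summxE; apply: eq_bigr => b _.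
  by rewrite linearZ mxE.
under eq_fun do rewrite fE.
apply: continuous_sum_ord => a; apply: continuous_sum_ord => b x.
by apply: cvgM; [exact: cF | exact: cvg_cst].
Qed.

End Continuity.

Section Minimum.
Variable R : realType.

Lemma mx_norm_le k l (M : 'M[R]_(k, l)) s :
  0 <= s -> (forall i j, `|M i j| <= s) -> `|M| <= s.
Proof.
by move=> s0 h; rewrite [leLHS]/Num.norm /= mx_normrE; apply/bigmax_leP; split.
Qed.

Lemma coord_le_norm k l (M : 'M[R]_(k, l)) i j : `|M i j| <= `|M|.
Proof.
rewrite [leRHS]/Num.norm /= mx_normrE.
by apply/bigmax_geP; right; exists (i, j).
Qed.

Lemma norm_sqn k l (M : 'M[R]_(k, l)) : `|M| ^+ 2 <= sqn M.
Proof.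
have s0 := sqn_ge0 M; rewrite -[leRHS](sqr_sqrtr s0) ler_sqr ?nnegrE ?sqrtr_ge0 //.
apply: mx_norm_le => [|i j]; first exact: sqrtr_ge0.
by rewrite -sqrtr_sqr ler_wsqrtr // sqn_coord.
Qed.

Lemma sqn_norm k l (M : 'M[R]_(k, l)) : sqn M <= (k * l)%:R * `|M| ^+ 2.
Proof.
rewrite /sqn mxdotE mulr_natl mulnC mulrnA -[X in _ *+ X]card_ord -sumr_const.
apply: ler_sum => i _; rewrite -[X in _ *+ X]card_ord -sumr_const.
apply: ler_sum => j _; rewrite -expr2 -real_normK ?num_real //.
by rewrite lerXn2r ?nnegrE // coord_le_norm.
Qed.

(** Transports compactness from row vectors to matrices. *)
Lemma vec_mx_continuous k l :
  continuous (vec_mx : 'rV[R]_(k * l) -> 'M[R]_(k, l)).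
Proof.
move=> v A [P nP PA]; rewrite /= nbhs_simpl /=.
pose Q (ij : 'I_k * 'I_l) := [set w : 'rV[R]_(k * l) | P ij.1 ij.2 (vec_mx w ij.1 ij.2)].
have : nbhs v [set w | forall ij, Q ij w].
  apply: (@filter_forall _ _ Q (nbhs v)) => -[i j].
  have nPv : nbhs (v ord0 (mxvec_index i j)) (P i j) by have := nP i j; rewrite mxE.
  have := @coord_continuous R 1 (k * l) ord0 (mxvec_index i j) v (P i j) nPv.
  apply: (@filterS _ (nbhs v) (nbhs_filter v)) => w; rewrite /Q /= mxE; exact.
by apply: (@filterS _ (nbhs v) (nbhs_filter v)) => w h; apply: PA => i j; exact: (h (i, j)).
Qed.

(** A bounded set cut out by any family of continuous inequalities is compact;
the family may be infinite, as for positive semidefiniteness. *)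
Lemma mx_attains_min k l (I : Type) (g : I -> 'M[R]_(k, l) -> R)
    (f : 'M[R]_(k, l) -> R) c x0 :
  (forall i, continuous (g i)) -> continuous f ->
  (forall x, (forall i, g i x <= 0) -> sqn x <= c) ->
  (forall i, g i x0 <= 0) ->
  exists2 x, (forall i, g i x <= 0) &
    forall y, (forall i, g i y <= 0) -> f x <= f y.
Proof.
move=> cg cf gc gx0.
pose A := [set v : 'rV[R]_(k * l) | forall i, g i (vec_mx v) <= 0].
have clA : closed A.
  rewrite (_ : A = \bigcap_(i in setT) [set v | g i (vec_mx v) <= 0]); last first.
    by apply/seteqP; split => v Av i; [move=> _; exact: Av | exact: (Av i Logic.I)].
  apply: closed_bigI => i _.
  apply: (@closed_comp _ _ (fun v => g i (vec_mx v)) [set x | x <= 0]).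
    by move=> v _; apply: continuous_comp; [exact: vec_mx_continuous | exact: cg].
  exact: closed_le.
have bA : bounded_set A.
  exists (1 + c); split; first exact: num_real.
  move=> M cM v /gc; rewrite -sqn_mxvec vec_mxK => vc; apply: le_trans (ltW cM).
  have := norm_sqn v; have := sqr_ge0 (`|v| - 1); nra.
have A0 : A !=set0 by exists (mxvec x0) => i; rewrite mxvecK.
have [|v Av vmin] := @EVT_min_rV R _ (f \o vec_mx) A A0 (bounded_closed_compact bA clA).
  apply: continuous_subspaceT => w.
  by apply: continuous_comp; [exact: vec_mx_continuous | exact: cf].
exists (vec_mx v); first by move/set_mem: Av.
move=> y gy; rewrite -(mxvecK y); apply: vmin; apply/mem_set => i.
by rewrite mxvecK.
Qed.

End Minimum.

(** * The constraint set near a regular factor *)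

(** The fixed point theorem needs matrices as a complete normed module. *)
HB.instance Definition _ (R : realType) (k l : nat) :=
  Uniform_isComplete.Build 'M[R]_(k, l) cauchy_cvg.

Section Constraint.
Variable R : realType.
Implicit Types q : nat.

(** [gr W] and [dg U W] are the matrices underlying [gram W] and [dgram U W],
the second being the derivative of the first at U in the direction W. *)
Definition gr n q (W : 'M[R]_(n, q)) : 'M[R]_n := W *m W^T.
Definition dg n q (U W : 'M[R]_(n, q)) : 'M[R]_n := U *m W^T + W *m U^T.

Lemma gr_sym n q (W : 'M[R]_(n, q)) : (gr W)^T = gr W.
Proof. by rewrite /gr trmx_mul trmxK. Qed.

Lemma dg_linear n q (U : 'M[R]_(n, q)) : linear (dg U).
Proof.
move=> c W W'; rewrite /dg linearP /= mulmxDr -scalemxAr mulmxDl -scalemxAl.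
by rewrite scalerDr addrACA.
Qed.

Lemma dgC n q (U W : 'M[R]_(n, q)) : dg U W = dg W U.
Proof. by rewrite /dg addrC. Qed.

Lemma gr_mul k n q (B : 'M[R]_(k, n)) (W : 'M[R]_(n, q)) :
  gr (B *m W) = B *m gr W *m B^T.
Proof. by rewrite /gr trmx_mul !mulmxA. Qed.

Lemma grD n q (U W : 'M[R]_(n, q)) : gr (U + W) = gr U + dg U W + gr W.
Proof. by rewrite /gr /dg linearD /= mulmxDl !mulmxDr !addrA. Qed.

Lemma grZ n q c (W : 'M[R]_(n, q)) : gr (c *: W) = c ^+ 2 *: gr W.
Proof. by rewrite /gr linearZ /= -scalemxAl -scalemxAr scalerA. Qed.

Lemma mxdot_gr n q (S : 'M[R]_n) (F : 'M[R]_(n, q)) :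
  mxdot S (gr F) = mxdot (S *m F) F.
Proof. by rewrite mxdotC /gr mxdot_mulr trmxK mxdotC. Qed.

Lemma mxdot_gr2 n k q (B : 'M[R]_(n, k)) (F : 'M[R]_(n, q)) :
  mxdot (gr B) (gr F) = sqn (B^T *m F).
Proof. by rewrite mxdot_gr /gr -mulmxA mxdot_mull. Qed.

Variables (n m : nat) (a : 'M[R]_n -> 'cV[R]_m) (s : 'cV[R]_m -> 'M[R]_n).
Hypotheses (la : linear a) (ls : linear s).
Hypothesis adj : forall l M, mxdot (s l) M = mxdot l (a M).
Hypothesis s_sym : forall l, (s l)^T = s l.

Let aD M N : a (M + N) = a M + a N.
Proof. by rewrite -[M in LHS]scale1r la scale1r. Qed.
Let aZ c M : a (c *: M) = c *: a M. Proof. exact: (linearZZ (mklin la)). Qed.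
Let aB M N : a (M - N) = a M - a N. Proof. exact: (linearB (mklin la)). Qed.

Lemma dot_dg_sym q (S : 'M[R]_n) (U W : 'M[R]_(n, q)) :
  S^T = S -> mxdot S (dg U W) = 2 * mxdot (S *m U) W.
Proof.
move=> sS; have E : mxdot S (W *m U^T) = mxdot (S *m U) W.
  by rewrite mxdotC mxdot_mulr trmxK mxdotC.
rewrite /dg mxdotDr E -mxdot_tr sS trmx_mul trmxK E; ring.
Qed.

Lemma adj_dg q l (U W : 'M[R]_(n, q)) :
  mxdot l (a (dg U W)) = 2 * mxdot (s l *m U) W.
Proof. by rewrite -adj dot_dg_sym. Qed.

(** The constraint map a acts on all square matrices, and s is its adjoint;
[ext] and [adjoint] below provide both. *)
Definition regular q (U : 'M[R]_(n, q)) := forall y, exists W, a (dg U W) = y.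

Lemma a_dg_linear q (U : 'M[R]_(n, q)) : linear (fun W => a (dg U W)).
Proof. by move=> c W W'; rewrite dg_linear la. Qed.

(** Every tangent direction is the velocity of a feasible curve.  The correction
t^2 K has to solve a (dg U K) = - a (gr (T + t K)); composing with a linear
right inverse g of a (dg U _) turns this into a fixed point equation for K,
which is a contraction of a ball when t is small. *)
Lemma feasible_curve q (U T : 'M[R]_(n, q)) :
  regular U -> a (dg U T) = 0 ->
  exists c h, [/\ 0 <= c, 0 < h & forall t, t ^+ 2 <= h ->
    exists2 K, sqn K <= c & a (gr (U + t *: T + t ^+ 2 *: K)) = a (gr U)].
Proof.
move=> regU tanT.
have [g gK] := lin_right_inverse (a_dg_linear U) regU.
have [ca ca0 hca] := lin_bound la.
have [cg cg0 hcg] := lin_bound (@linearP _ _ _ _ g).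
(* C bounds g o a.  For t^2 <= 1 / d the map F below preserves the ball of
   squared radius c and contracts by 1/2; n q compares sqn with the norm. *)
pose C := cg * ca; have C0 : 0 <= C by exact: mulr_ge0.
pose tau := 2 * sqn T + 1; have tau1 : 1 <= tau by have := sqn_ge0 T; rewrite /tau; lra.
pose c := C * tau ^+ 2; have c0 : 0 <= c by rewrite mulr_ge0 ?sqr_ge0.
pose d := 2 * c + 16 * C * tau * (n * q)%:R + 1.
have d0 : 0 < d.
  rewrite /d ltr_wpDl // addr_ge0 ?mulr_ge0 //; lra.
exists c, d^-1; split=> // [|t th]; first by rewrite invr_gt0.
have td : t ^+ 2 * d <= 1 by rewrite -ler_pdivlMr // mul1r.
have t0 := sqr_ge0 t.
have tc : t ^+ 2 * (2 * c) <= 1.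
  apply: le_trans td; rewrite ler_wpM2l // /d -addrA lerDl addr_ge0 ?mulr_ge0 //; lra.
have tC : t ^+ 2 * (16 * C * tau * (n * q)%:R) <= 1.
  apply: le_trans td; rewrite ler_wpM2l // /d -addrA addrCA lerDl addr_ge0 ?mulr_ge0 //; lra.
pose F K := - g (a (gr (T + t *: K))).
have hF M : sqn (g (a M)) <= C * sqn M.
  by apply: le_trans (hcg _) _; rewrite -mulrA ler_wpM2l.
have hT K : sqn K <= c -> sqn (T + t *: K) <= tau.
  move=> Kc; apply: le_trans (sqnD _ _) _; rewrite sqnZ /tau lerD2l mulrCA.
  by apply: le_trans tc; rewrite ler_wpM2l // ler_wpM2l.
pose B := [set K : 'M[R]_(n, q) | sqn K <= c].
have FB : set_fun B B F.
  move=> K; rewrite /B /= => Kc; rewrite /F sqnN; apply: le_trans (hF _) _.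
  rewrite /c ler_wpM2l //; apply: le_trans (sqn_gram _) _.
  by rewrite lerXn2r ?nnegrE ?sqn_ge0 ?hT //; lra.
have ctrF : is_contraction (mkfun FB).
  exists (2^-1)%:nng; split; first by rewrite /=; lra.
  move=> [K K'] [/= Kc K'c]; rewrite -[mkfun _ K]/(F K) -[mkfun _ K']/(F K').
  rewrite -ler_sqr ?nnegrE ?mulr_ge0 // exprMn; apply: le_trans (norm_sqn _) _.
  have -> : F K - F K' = - g (a (gr (T + t *: K) - gr (T + t *: K'))).
    by rewrite /F aB linearB opprB opprK addrC.
  rewrite sqnN; apply: le_trans (hF _) _.
  have -> : gr (T + t *: K) - gr (T + t *: K') =
      t *: ((K - K') *m (T + t *: K)^T + (T + t *: K') *m (K - K')^T).
    rewrite /gr scalerDr scalemxAl (scalemxAr t) -[t *: (K - K')^T]linearZ /=.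
    have -> : t *: (K - K') = (T + t *: K) - (T + t *: K').
      by rewrite opprD addrACA subrr add0r scalerBr.
    by rewrite [(_ - _)^T]linearB /= mulmxBl mulmxBr addrA subrK.
  rewrite sqnZ; apply: (@le_trans _ _ (C * (t ^+ 2 * (4 * tau * sqn (K - K'))))).
    rewrite ler_wpM2l // ler_wpM2l //; apply: le_trans (sqnD _ _) _.
    have := sqnM (K - K') (T + t *: K)^T; have := sqnM (T + t *: K') (K - K')^T.
    rewrite !sqn_tr; have := hT _ Kc; have := hT _ K'c; have := sqn_ge0 (K - K'); nra.
  have := sqn_norm (K - K'); set x := sqn _; set y := `|_|; set nq := (n * q)%:R => xy.
  apply: (@le_trans _ _ (t ^+ 2 * (4 * C * tau) * (nq * y ^+ 2))).
    rewrite [leLHS](_ : _ = t ^+ 2 * (4 * C * tau) * x); last by ring.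
    by rewrite ler_wpM2l // mulr_ge0 // mulr_ge0 ?mulr_ge0 //; lra.
  rewrite [leLHS](_ : _ = t ^+ 2 * (16 * C * tau * nq) * (4^-1 * y ^+ 2)); last by field.
  rewrite -[leRHS]mul1r [X in _ <= _ * (X * _)](_ : _ = 4^-1); last by field.
  by rewrite ler_wpM2r // mulr_ge0 ?sqr_ge0 //; lra.
have clB : closed B.
  apply: (@closed_comp _ _ (@sqn R n q) [set x | x <= c]) (@closed_le _ _) => K _.
  by apply: mxcts_dot; exact: mxcts_id.
have [|K Kc KF] := banach_fixed_point ctrF clB; first by exists 0; rewrite /B /= sqn0.
have KF' : K = F K by [].
exists K => //; have -> : U + t *: T + t ^+ 2 *: K = U + t *: (T + t *: K).
  by rewrite -addrA scalerDr scalerA expr2.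
have dE : dg U (t *: (T + t *: K)) = t *: dg U T + t ^+ 2 *: dg U K.
  rewrite scalerDr scalerA -expr2 dg_linear; congr (_ + _).
  exact: (linearZZ (mklin (dg_linear U))).
have dKE : a (dg U K) = - a (gr (T + t *: K)).
  rewrite {1}KF' /F; set y := a (gr _).
  by have /= -> := linearN (mklin (a_dg_linear U)) (g y); rewrite gK.
by rewrite grD grZ dE aD aD aD !aZ tanT dKE scaler0 add0r scalerN subrK.
Qed.

(** Regularity of U is surjectivity of a (dg U _), hence injectivity of its
adjoint l |-> 2 s l U. *)
Lemma regular_adjoint_inj q (U : 'M[R]_(n, q)) :
  regular U -> forall l, s l *m U = 0 -> l = 0.
Proof.
move=> regU l sU; apply: sqn_le0; have [W Wl] := regU l.
by rewrite /sqn -{2}Wl adj_dg sU mxdot0l mulr0.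
Qed.

Lemma adjoint_mul_linear q (U : 'M[R]_(n, q)) : linear (fun l => s l *m U).
Proof. by move=> c x y; rewrite ls mulmxDl -scalemxAl. Qed.

(** The tangential part of Z is Z - s l U: the map l |-> a (dg U (s l U)) is
definite, hence invertible. *)
Lemma tangent_projection q (U : 'M[R]_(n, q)) :
  (forall l, s l *m U = 0 -> l = 0) ->
  forall Z, exists l, a (dg U (Z - s l *m U)) = 0.
Proof.
move=> inj Z; pose M l := a (dg U (s l *m U)).
have lM : linear M by move=> c x y; rewrite /M adjoint_mul_linear a_dg_linear.
have [|l Ml] := lin_inj_surj lM _ (a (dg U Z)).
  move=> l /(congr1 (mxdot l)); rewrite /M adj_dg mxdot0r => h; apply: inj.
  by apply: sqn_le0; rewrite /sqn; lra.
exists l; have /= -> := linearB (mklin (a_dg_linear U)) Z (s l *m U).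
by rewrite [a (dg U (s l *m U))]Ml subrr.
Qed.

Lemma injective_regular q (U : 'M[R]_(n, q)) :
  (forall l, s l *m U = 0 -> l = 0) -> regular U.
Proof.
move=> inj y; pose M l := a (dg U (s l *m U)).
have lM : linear M by move=> c x z; rewrite /M adjoint_mul_linear a_dg_linear.
have [|l Ml] := lin_inj_surj lM _ y; last by exists (s l *m U).
move=> l /(congr1 (mxdot l)); rewrite /M adj_dg mxdot0r => h; apply: inj.
by apply: sqn_le0; rewrite /sqn; lra.
Qed.

(** A direction orthogonal to the tangent space is a combination of constraint
gradients. *)
Lemma lagrange_multiplier q (U Z : 'M[R]_(n, q)) : regular U ->
  (forall W, a (dg U W) = 0 -> mxdot Z W = 0) -> exists l, Z = s l *m U.
Proof.
move=> /regular_adjoint_inj inj ort; have [l tl] := tangent_projection inj Z.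
exists l; apply/eqP; rewrite -subr_eq0; apply/eqP; apply: sqn_le0.
rewrite /sqn {1}mxdotBl (ort _ tl).
have := adj_dg l U (Z - s l *m U); rewrite tl mxdot0r.
lra.
Qed.

(** A step d with B d at most 1/2 for which the parameter t = b d satisfies
t^2 <= h; it decides the sign of b in the next two lemmas. *)
Lemma small_step (b B h : R) : 0 <= B -> 0 < h ->
  exists d, [/\ 0 < d, 2 * B * d <= 1 & (b * d) ^+ 2 <= h].
Proof.
move=> B0 h0; pose D := 1 + 2 * B + b ^+ 2 / h.
have q0 : 0 <= b ^+ 2 / h by rewrite divr_ge0 ?sqr_ge0 // ltW.
have D1 : 1 <= D by rewrite /D; lra.
have D0 : 0 < D by lra.
have Dd : D * D^-1 = 1 by rewrite mulfV // gt_eqF.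
have bD : b ^+ 2 / h <= D by rewrite /D; lra.
have BD : 2 * B <= D by rewrite /D; lra.
have d0 : 0 < D^-1 by rewrite invr_gt0.
exists D^-1; split=> //; first by nra.
have hb : b ^+ 2 <= h * D by rewrite mulrC -ler_pdivrMr.
have d1 : D^-1 <= 1 by nra.
rewrite exprMn; apply: (@le_trans _ _ (h * D * D^-1 ^+ 2)).
  by rewrite ler_wpM2r ?sqr_ge0.
by rewrite expr2 mulrA -(mulrA h) Dd mulr1 ler_piMr // ltW.
Qed.

Lemma first_order_ge0 (b B h : R) : 0 <= B -> 0 < h ->
  (forall t, t ^+ 2 <= h -> 0 <= t * b + B * t ^+ 2) -> b = 0.
Proof.
move=> B0 h0 H; have [d [d0 Bd bd]] := small_step b B0 h0.
have := H (- (b * d)); rewrite sqrrN => /(_ bd) Ht.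
have b0 := sqr_ge0 b; apply/eqP; rewrite -sqrf_eq0 eq_le b0 andbT.
have : 0 <= (b ^+ 2 * d) * (B * d - 1) by apply: le_trans Ht _; rewrite le_eqVlt; apply/orP; left; apply/eqP; ring.
move=> Hd; rewrite leNgt; apply/negP => bp.
have : 0 < b ^+ 2 * d by rewrite mulr_gt0.
nra.
Qed.

Lemma second_order_ge0 (b B h : R) : 0 <= B -> 0 < h ->
  (forall t, 0 < t -> t ^+ 2 <= h -> 0 <= b + B * t) -> 0 <= b.
Proof.
move=> B0 h0 H; have [d [d0 Bd bd]] := small_step b B0 h0.
rewrite leNgt; apply/negP => bn.
have := H (- (b * d)); rewrite sqrrN oppr_gt0 pmulr_llt0 // => /(_ bn bd) Ht.
have : 0 <= b * (1 - B * d) by apply: le_trans Ht _; rewrite le_eqVlt; apply/orP; left; apply/eqP; ring.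
nra.
Qed.

(** Along a feasible curve the cost varies by 2 t <C U, T> + O(t^2), and by
t^2 <S T, T> + O(t^3) in terms of the slack S = C - s l, because S U = 0 and
s l is constant on the feasible set.  Nearness is measured on gr W, so that
minimality modulo rotations suffices. *)
Lemma second_order_conditions q (C : 'M[R]_n) (U : 'M[R]_(n, q)) e :
  C^T = C -> regular U -> 0 < e ->
  (forall W : 'M[R]_(n, q), a (gr W) = a (gr U) -> sqn (gr W - gr U) <= e ->
     mxdot C (gr U) <= mxdot C (gr W)) ->
  exists2 l, (C - s l) *m U = 0 &
    forall T, a (dg U T) = 0 -> 0 <= mxdot ((C - s l) *m T) T.
Proof.
move=> CT regU e0 minU.
have [cd cd0 hcd] := lin_bound (dg_linear U).
have curve T : a (dg U T) = 0 -> exists x h, [/\ 0 <= x, 0 < h & forall t, t ^+ 2 <= h ->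
    exists K, let X := T + t *: K in [/\ sqn K <= x, sqn X <= x, t ^+ 2 <= 1,
      a (gr (U + t *: X)) = a (gr U) &
      0 <= t * mxdot C (dg U X) + t ^+ 2 * mxdot C (gr X)]].
  move=> tanT; have [c [h [c0 h0 cur]]] := feasible_curve regU tanT.
  pose x := 2 * sqn T + 2 * c; have x0 : 0 <= x by rewrite /x; have := sqn_ge0 T; lra.
  pose D := 2 * cd * x + 2 * x ^+ 2 + 1.
  have D0 : 0 < D.
    have := mulr_ge0 cd0 x0; have := sqr_ge0 x; rewrite /D; lra.
  exists x, (Num.min h (Num.min 1 (e / D))); split=> //.
    by rewrite !lt_min h0 ltr01 divr_gt0.
  move=> t; rewrite !le_min => /and3P[th t1]; rewrite ler_pdivlMr // => te.
  have [K Kc aK] := cur t th; exists K => X.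
  have t0 := sqr_ge0 t; have K0 := sqn_ge0 K; have T0 := sqn_ge0 T.
  have Kx : sqn K <= x by rewrite /x; lra.
  have Xx : sqn X <= x.
    by apply: le_trans (sqnD _ _) _; rewrite sqnZ /x; nra.
  have WE : U + t *: X = U + t *: T + t ^+ 2 *: K.
    by rewrite /X scalerDr scalerA expr2 addrA.
  have dE : gr (U + t *: X) - gr U = t *: dg U X + t ^+ 2 *: gr X.
    rewrite grD grZ -(addrA (gr U)) [LHS]addrC addKr; congr (_ + _).
    exact: (linearZZ (mklin (dg_linear U))).
  split=> //; first by rewrite WE.
  have : mxdot C (gr U) <= mxdot C (gr (U + t *: X)).
    apply: minU; first by rewrite WE.
    rewrite dE expr2 -scalerA -scalerDr sqnZ; apply: le_trans te.
    rewrite ler_wpM2l //; apply: le_trans (sqnD _ _) _; rewrite sqnZ.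
    have := hcd X; have := sqn_gram X; rewrite -[X *m X^T]/(gr X) => h1 h2.
    have h3 : sqn X ^+ 2 <= x ^+ 2 by rewrite lerXn2r ?nnegrE ?sqn_ge0.
    have h4 : cd * sqn X <= cd * x by rewrite ler_wpM2l.
    have h5 : t ^+ 2 * sqn (gr X) <= sqn (gr X) by rewrite ler_piMl ?sqn_ge0.
    by rewrite /D; lra.
  by rewrite -subr_ge0 -mxdotBr dE mxdotDr !mxdotZr.
have [l Cl] : exists l, C *m U = s l *m U.
  apply: lagrange_multiplier => // T tanT.
  have [x [h [x0 h0 cur]]] := curve T tanT.
  apply: (first_order_ge0 (B := sqn (C *m U) + sqn C + x + x ^+ 2) _ h0).
    by have := sqn_ge0 (C *m U); have := sqn_ge0 C; have := sqr_ge0 x; lra.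
  move=> t th; have [K [Kx Xx t1 _]] := cur t th.
  rewrite dot_dg_sym // mxdotDr mxdotZr.
  set X := T + _ in Xx *; have := mxdot_AMGM (C *m U) K; have := mxdot_AMGM C (gr X).
  have := sqn_gram X; rewrite -[X *m X^T]/(gr X) => h1 h2 h3.
  have h4 : sqn X ^+ 2 <= x ^+ 2 by rewrite lerXn2r ?nnegrE ?sqn_ge0.
  have := ler_norm (mxdot (C *m U) K); have := ler_norm (mxdot C (gr X)).
  have := sqr_ge0 t; have := sqn_ge0 (C *m U); have := sqn_ge0 C.
  move: (mxdot (C *m U) K) (mxdot C (gr X)) h2 h3 => u v; nra.
exists l => [|T tanT]; first by rewrite mulmxBl Cl subrr.
set S := C - s l; have SU : S *m U = 0 by rewrite mulmxBl Cl subrr.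
have ST : S^T = S by rewrite /S linearB /= CT s_sym.
have [x [h [x0 h0 cur]]] := curve T tanT.
apply: (second_order_ge0 (B := sqn (S *m T) + sqn S + x + x ^+ 2) _ h0).
  by have := sqn_ge0 (S *m T); have := sqn_ge0 S; have := sqr_ge0 x; lra.
move=> t t0 th; have [K [Kx Xx t1 aX]] := cur t th; set X := T + _ in Xx aX *.
have split_cost : t * mxdot C (dg U X) + t ^+ 2 * mxdot C (gr X) =
    t ^+ 2 * mxdot (S *m X) X.
  have lin M : mxdot C M = mxdot S M + mxdot l (a M).
    by rewrite -adj -mxdotDl /S subrK.
  have a_gr : t *: a (dg U X) + t ^+ 2 *: a (gr X) = 0.
    move: aX; rewrite grD grZ aD aD aZ -addrA => /(canRL (addKr _)).
    have /= -> := linearZZ (mklin (a_dg_linear U)) t X.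
    by rewrite addNr.
  rewrite !lin !mulrDr addrACA -!(mxdotZr _ l) -mxdotDr a_gr mxdot0r addr0.
  rewrite dot_dg_sym // SU mxdot0l mulr0 mulr0 add0r.
  by rewrite mxdotC /gr mxdot_mulr trmxK mxdotC.
rewrite split_cost pmulr_rge0 ?exprn_gt0 // => SX.
have SXE : mxdot (S *m X) X =
    mxdot (S *m T) T + t * (2 * mxdot (S *m T) K) + t ^+ 2 * mxdot S (gr K).
  have -> : mxdot S (gr K) = mxdot (S *m K) K.
    by rewrite mxdotC /gr mxdot_mulr trmxK mxdotC.
  have SKT : mxdot (S *m K) T = mxdot (S *m T) K by rewrite mxdot_mull ST mxdotC.
  rewrite /X mulmxDr -scalemxAr !(mxdotDl, mxdotDr, mxdotZl, mxdotZr) SKT; ring.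
rewrite {}SXE in SX; apply: le_trans SX _; rewrite -addrA lerD2l.
have := mxdot_AMGM (S *m T) K; have := mxdot_AMGM S (gr K).
have := sqn_gram K; rewrite -[K *m K^T]/(gr K) => h1 h2 h3.
have h4 : sqn K ^+ 2 <= x ^+ 2 by rewrite lerXn2r ?nnegrE ?sqn_ge0.
have := ler_norm (mxdot (S *m T) K); have := ler_norm (mxdot S (gr K)).
have t_le1 : t <= 1 by rewrite -(@expr_le1 _ 2) // ltW.
have := sqn_ge0 S; move: (mxdot (S *m T) K) (mxdot S (gr K)) h2 h3 => u v h2 h3 S0 hv hu.
have {h3 hu} hu : 2 * u <= sqn (S *m T) + x by lra.
have {h2 hv} hv : v <= sqn S + x ^+ 2 by have := sqr_ge0 x; lra.
have B0 : 0 <= sqn S + x ^+ 2 by have := sqr_ge0 x; lra.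
have tt : t ^+ 2 * (sqn S + x ^+ 2) <= t * (sqn S + x ^+ 2).
  by rewrite ler_wpM2r // expr2 ler_piMl // ltW.
have := ler_wpM2l (ltW t0) hu; have := ler_wpM2l (sqr_ge0 t) hv; lra.
Qed.

End Constraint.

(** * Positive semidefinite matrices as Gram matrices *)

Section PSD.
Variable R : realType.

Lemma mxdot_col_mx k1 k2 l (A C : 'M[R]_(k1, l)) (B D : 'M[R]_(k2, l)) :
  mxdot (col_mx A B) (col_mx C D) = mxdot A C + mxdot B D.
Proof. by rewrite /mxdot tr_col_mx mul_row_col linearD. Qed.

Lemma mxdot11 (M N : 'M[R]_1) : mxdot M N = M 0 0 * N 0 0.
Proof. by rewrite mxdotE !big_ord1. Qed.

Lemma psdmxP n (X : 'M[R]_n) :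
  psdmx X <-> forall x : 'cV_n, 0 <= mxdot (X *m x) x.
Proof.
have E (x : 'cV[R]_n) : (x^T *m X *m x) 0 0 = mxdot (X *m x) x.
  by rewrite mxdotC /mxdot trace_mx11 mulmxA.
by split=> h x; [rewrite -E | rewrite E].
Qed.

Lemma psd_gr n q (F : 'M[R]_(n, q)) : psdmx (gr F).
Proof.
apply/psdmxP => x; rewrite /gr -mulmxA mxdot_mull; exact: sqn_ge0.
Qed.

Lemma psd_block n (al : R) (v : 'cV[R]_n) (M : 'M[R]_n) (s : R) (y : 'cV[R]_n) :
  psdmx (block_mx (al%:M : 'M[R]_1) v^T v M) ->
  0 <= al * s ^+ 2 + 2 * s * mxdot v y + mxdot (M *m y) y.
Proof.
move=> /psdmxP /(_ (col_mx s%:M y)).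
rewrite mul_block_col mxdot_col_mx !mxdotDl !mul_mx_scalar !mxdotZl !mxdot11.
have -> : (v^T *m y) 0 0 = mxdot v y by rewrite /mxdot trace_mx11.
rewrite !mxE !eqxx !mulr1n => H; lra.
Qed.

Lemma gr_block n (c : R) (v : 'cV[R]_n) (F : 'M[R]_n) :
  gr (block_mx (c%:M : 'M[R]_1) 0 v F) =
  block_mx (c * c)%:M (c *: v)^T (c *: v) (gr v + gr F).
Proof.
rewrite /gr tr_block_mx mulmx_block tr_scalar_mx trmx0 !mulmx0 !mul0mx !addr0.
by rewrite -scalar_mxM mul_scalar_mx mul_mx_scalar linearZ.
Qed.

(** Cholesky factorization, by induction on the size: a zero pivot forces its
whole row to vanish, and otherwise the Schur complement is again positive
semidefinite. *)
Lemma psd_factor n (X : 'M[R]_n) :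
  X^T = X -> psdmx X -> exists F : 'M[R]_n, X = gr F.
Proof.
elim: n X => [|n IH] X; first by exists 0; apply/matrixP => -[].
change ('M[R]_(1 + n)) in X => XT pX.
pose al := X 0 0; pose v := dlsubmx X; pose M := drsubmx X.
have XE : X = block_mx al%:M v^T v M.
  rewrite -[LHS]submxK; congr block_mx.
    by rewrite [LHS]mx11_scalar !mxE; congr (X _ _)%:M; apply/val_inj.
  by rewrite /v trmx_dlsub XT.
have MT : M^T = M by rewrite /M trmx_drsub XT.
rewrite XE in pX.
have al0 : 0 <= al.
  by have := psd_block 1 0 pX; rewrite mulmx0 !mxdotlin; lra.
have [al_le0|al_gt0] := leP al 0.
  (* With a zero pivot the form is affine in the first coordinate, so its
     slope vanishes. *)
  have al_0 : al = 0 by apply/eqP; rewrite eq_le al_le0.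
  have v0 : v = 0.
    apply: sqn_le0; have c0 := psd_block 0 v pX; rewrite leNgt; apply/negP => v0.
    have := psd_block (- (mxdot (M *m v) v + 1) / sqn v) v pX.
    move: c0; rewrite al_0 -/(sqn v) expr0n /= mulr0 mul0r !add0r mulr0 mul0r add0r.
    by rewrite !mulrA -(mulrA _ _ (sqn v)) mulVf ?gt_eqF //; lra.
  have [|F MF] := IH M MT.
    by apply/psdmxP => y; have := psd_block 0 y pX; lra.
  exists (block_mx (0%:M : 'M[R]_1) 0 0 F).
  by rewrite gr_block XE al_0 v0 MF mulr0 scaler0 trmx0 /gr mul0mx add0r.
pose rt := Num.sqrt al; have rt0 : rt != 0 by rewrite sqrtr_eq0 -ltNge.
have rt2 : rt * rt = al by rewrite -expr2 sqr_sqrtr.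
have [||F MF] := IH (M - al^-1 *: gr v).
- by rewrite linearB linearZ /= gr_sym MT.
(* The chosen first coordinate minimizes the form. *)
- apply/psdmxP => y; have := psd_block (- al^-1 * mxdot v y) y pX.
  rewrite mulmxBl mxdotBl -scalemxAl mxdotZl.
  have -> : mxdot (gr v *m y) y = mxdot v y * mxdot v y.
    by rewrite /gr -mulmxA mxdot_mull mxdot11 /mxdot trace_mx11.
  set b := mxdot v y; set c := mxdot _ _.
  rewrite [X in 0 <= X -> _](_ : _ = c - al^-1 * (b * b)) //; field.
  by rewrite gt_eqF.
exists (block_mx (rt%:M : 'M[R]_1) 0 (rt^-1 *: v) F).
rewrite gr_block -MF rt2 scalerA mulfV // scale1r grZ exprVn expr2 rt2.
by rewrite addrC subrK.
Qed.

Lemma rank_gr n q (F : 'M[R]_(n, q)) : (\rank (gr F) = \rank F)%N.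
Proof.
apply/eqP; rewrite eqn_leq mxrankM_maxl /=.
have : kermx (gr F) *m F = 0.
  by apply: sqn_le0; rewrite /sqn mxdot_mulr -mulmxA mulmx_ker mxdot0r.
move/mulmx0_rank_max; rewrite mxrank_ker addnC addnBA ?rank_leq_row //.
by rewrite leq_subLR leq_add2r.
Qed.

(** Factor through the row space first, which has dimension the rank, and pad
the factor with zero columns. *)
Lemma psd_low_rank n p (X : 'M[R]_n) :
  X^T = X -> psdmx X -> (\rank X <= p)%N -> exists U : 'M[R]_(n, p), X = gr U.
Proof.
move=> XT pX rX; have [F XF] := psd_factor XT pX.
have rp : (\rank F <= p)%N by rewrite -rank_gr -XF.
pose G := row_base F.
have [H GH] := psd_factor (gr_sym G) (psd_gr G).
have -> : X = gr (col_base F *m H).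
  by rewrite XF -{1}(mulmx_base F) !(gr_mul (col_base F)) GH.
exists (col_base F *m H *m pid_mx (\rank F)); rewrite [RHS]gr_mul.
rewrite {2}/gr tr_pid_mx mul_pid_mx minnn (minn_idPr rp) pid_mx_1 mulmx1.
by rewrite /gr.
Qed.

End PSD.

(** * The unperturbed cost and its growth at X0 and at V *)

Section Construction.
Variables (R : realType) (n m p : nat).
Variables (a : 'M[R]_n -> 'cV[R]_m) (s : 'cV[R]_m -> 'M[R]_n).
Hypotheses (la : linear a) (ls : linear s).
Hypothesis adj : forall l M, mxdot (s l) M = mxdot l (a M).
Hypothesis s_sym : forall l, (s l)^T = s l.
Variables (X0 : 'M[R]_n) (V : 'M[R]_(n, p)) (L : 'M[R]_(p, n)).
Hypothesis X0_sym : X0^T = X0.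
Hypothesis LV : L *m V = 1%:M.
Hypothesis transversal : forall k (G : 'M[R]_(n, k)) H, X0 *m G = V *m H -> X0 *m G = 0.
Hypothesis secant : forall W G H, a (dg V W) = 0 -> W = X0 *m G + V *m H ->
  exists2 T : 'M[R]_p, T^T = - T & W = V *m T.

(** By the Fredholm alternative it suffices that no (Z1, Z2) with tr Z1 <> 0
annihilates the range of nu |-> (V^T s nu V, V^T s nu X0).  An annihilator
gives the tangent direction W = X0 Z2^T + V H, H the symmetric part of Z1;
secancy makes H skew as well, so that H = 0. *)
Lemma dual_certificate : exists nu,
  V^T *m s nu *m V = 1%:M /\ V^T *m s nu *m X0 = 0.
Proof.
pose f nu := V^T *m s nu *m row_mx V X0.
have lf : linear f.
  by move=> c x y; rewrite /f ls mulmxDr -scalemxAr mulmxDl -scalemxAl.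
have [|nu] := lin_solvable (y := row_mx 1%:M 0) lf; last first.
  by rewrite /f mul_mx_row => /eq_row_mx[? ?]; exists nu.
move=> z zf; pose Z1 := lsubmx z; pose Z2 := rsubmx z.
have zE : z = row_mx Z1 Z2 by rewrite hsubmxK.
pose E := V *m Z1 *m V^T + V *m Z2 *m X0.
have dotE nu : mxdot z (f nu) = mxdot (s nu) E.
  rewrite zE /f mul_mx_row -mxdot_tr !tr_row_mx mxdot_col_mx !mxdot_tr.
  have h k (B : 'M[R]_(n, k)) (Z : 'M[R]_(p, k)) :
      mxdot Z (V^T *m s nu *m B) = mxdot (s nu) (V *m Z *m B^T).
    by rewrite (mxdotC (s nu)) mxdot_mulr trmxK mxdot_mull mulmxA.
  by rewrite !h X0_sym -mxdotDr.
have aE : a E = 0 by apply: sqn_le0; rewrite /sqn -adj -dotE zf.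
have aET : a E^T = 0.
  by apply: sqn_le0; rewrite /sqn -adj -mxdot_tr trmxK s_sym adj aE mxdot0r.
pose H := 2^-1 *: (Z1 + Z1^T).
have H_sym : H^T = H by rewrite /H linearZ linearD /= trmxK addrC.
pose W := X0 *m Z2^T + V *m H.
have dgW : dg V W = E + E^T.
  have WT : W^T = Z2 *m X0 + H *m V^T.
    by rewrite /W linearD /= !trmx_mul trmxK X0_sym H_sym.
  have ET : E^T = V *m Z1^T *m V^T + X0 *m Z2^T *m V^T.
    by rewrite /E linearD /= !trmx_mul trmxK X0_sym !mulmxA.
  have HE : V *m H *m V^T + V *m H *m V^T = V *m Z1 *m V^T + V *m Z1^T *m V^T.
    rewrite -!(mulmxDl _ _ V^T) -!mulmxDr; congr (_ *m _ *m _).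
    by rewrite /H -scalerDl (_ : 2^-1 + 2^-1 = 1) ?scale1r //; field.
  rewrite ET /E /dg WT /W mulmxDr mulmxDl !mulmxA.
  by rewrite addrACA HE addrC addrACA.
have aW : a (dg V W) = 0 by rewrite dgW; have := la 1 E E^T; rewrite !scale1r aE aET addr0.
have [T T_skew WT] := secant aW (erefl W).
have HT : H = T.
  have XV : X0 *m Z2^T = V *m (T - H) by rewrite mulmxBr -WT /W addrK.
  have := congr1 (mulmx L) XV; rewrite (transversal XV) mulmx0 mulmxA LV mul1mx.
  by move/esym/eqP; rewrite subr_eq0 => /eqP.
have trH : \tr H = 0 by have := mxtrace_tr T; rewrite T_skew linearN /= -HT; lra.
have trZ1 : \tr H = \tr Z1 by rewrite /H mxtraceZ mxtraceD mxtrace_tr; field.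
rewrite zE -mxdot_tr !tr_row_mx mxdot_col_mx !mxdot_tr mxdot0r addr0.
by rewrite mxdotC /mxdot trmx1 mul1mx -trZ1.
Qed.

Lemma annihilator : exists Y : 'M[R]_(n),
  [/\ Y *m X0 = 0, Y *m V = 0 & forall k (x : 'M[R]_(n, k)), Y *m x = 0 ->
     exists G H, x = X0 *m G + V *m H].
Proof.
pose E := row_mx X0 V; pose Y := (cokermx E^T)^T.
have YE : Y *m E = 0 by rewrite /Y -[E]trmxK -trmx_mul trmxK mulmx_coker trmx0.
move: (YE); rewrite mul_mx_row -[X in _ = X](row_mx0) => /eq_row_mx[YX YV].
exists Y; split=> // k x Yx.
have /submxP[D xD] : (x^T <= E^T)%MS.
  by rewrite submxE -[cokermx _]trmxK -trmx_mul Yx trmx0.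
exists (usubmx D^T), (dsubmx D^T).
by rewrite -mul_row_col vsubmxK -[LHS]trmxK xD trmx_mul trmxK.
Qed.

Section Growth.
Variables (Y : 'M[R]_n) (nu : 'cV[R]_m).
Hypotheses (YX : Y *m X0 = 0) (YV : Y *m V = 0).
Hypothesis Y_ker : forall k (x : 'M[R]_(n, k)), Y *m x = 0 ->
     exists G H, x = X0 *m G + V *m H.
Hypotheses (nuV : V^T *m s nu *m V = 1%:M) (nuX : V^T *m s nu *m X0 = 0).

(** Its slack at V is [cost K - s nu], and at X0 it is its own slack matrix. *)
Definition cost K : 'M[R]_n := gr (s nu *m V) + K *: gr Y^T.

Lemma cost_sym K : (cost K)^T = cost K.
Proof. by rewrite /cost linearD linearZ /= !gr_sym. Qed.

Lemma costV K : cost K *m V = s nu *m V.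
Proof.
rewrite /cost mulmxDl -scalemxAl /gr trmxK -!mulmxA YV mulmx0 scaler0 addr0.
by rewrite trmx_mul s_sym nuV mulmx1.
Qed.

Lemma costX K : cost K *m X0 = 0.
Proof.
rewrite /cost mulmxDl -scalemxAl /gr trmxK -!mulmxA YX mulmx0 scaler0 addr0.
by rewrite trmx_mul s_sym nuX !mulmx0.
Qed.

Lemma cost_dot K q (F : 'M[R]_(n, q)) :
  mxdot (cost K) (gr F) = sqn ((s nu *m V)^T *m F) + K * sqn (Y *m F).
Proof.
by rewrite /cost mxdotDl mxdotZl !mxdot_gr2 trmxK.
Qed.

Lemma cost_kernel K k (D : 'M[R]_(n, k)) :
  0 < K -> cost K *m D = 0 -> exists G, D = X0 *m G.
Proof.
move=> K0 SD; have : mxdot (cost K) (gr D) = 0.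
  by rewrite mxdot_gr SD mxdot0l.
rewrite cost_dot => sum0; have B0 := sqn_ge0 ((s nu *m V)^T *m D).
have Y0 := mulr_ge0 (ltW K0) (sqn_ge0 (Y *m D)).
have BD : (s nu *m V)^T *m D = 0 by apply: sqn_le0; lra.
have YD : Y *m D = 0 by apply: sqn_le0; rewrite -(pmulr_rle0 _ K0); lra.
have [G [H DE]] := Y_ker YD; exists G; rewrite DE.
move: BD; rewrite DE trmx_mul s_sym mulmxDr !mulmxA nuX nuV mul0mx mul1mx add0r => ->.
by rewrite mulmx0 addr0.
Qed.

(** On symmetric D with a D = 0, the map D |-> S0 D is injective: S0 D = 0 puts
D in the face of X0, where extremality leaves only 0.  So |X - X0|^2 is
bounded by |S0 X|^2, and the latter by <S0, X> since both matrices are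
positive semidefinite. *)
Lemma growth_at_extreme_point K : 0 < K ->
  (forall D : 'M[R]_n, D^T = D -> a D = 0 -> (exists G, D = X0 *m G) -> D = 0) ->
  exists2 kappa, 0 < kappa & forall X : 'M[R]_n,
    X^T = X -> psdmx X -> a X = a X0 -> sqn (X - X0) <= 1 ->
    kappa * sqn (X - X0) <= mxdot (cost K) (X - X0).
Proof.
move=> K0 ext; pose S0 := cost K.
have lS : linear (fun D : 'M[R]_n => S0 *m D).
  by move=> c x y; rewrite mulmxDr -scalemxAr.
have lskew : linear (fun D : 'M[R]_n => D - D^T).
  by move=> c x y; rewrite linearP /= scalerBr opprD addrACA.
have [D aD SD DT|c c0 hc] := lin_inj_bound la lS lskew.
  apply: ext => //; last exact: cost_kernel SD.
  by apply/esym/eqP; rewrite -subr_eq0 DT.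
pose f := sqn (1%:M : 'M[R]_n) + 2 * sqn X0 + 2.
pose b := 2 * (sqn (s nu *m V) + K * sqn Y).
have f0 : 0 < f by rewrite /f; have := sqn_ge0 (1%:M : 'M[R]_n); have := sqn_ge0 X0; lra.
have b0 : 0 <= b.
  by rewrite /b mulr_ge0 // addr_ge0 ?sqn_ge0 // mulr_ge0 ?sqn_ge0 // ltW.
pose g := c * f * b + 1.
have g0 : 0 < g by rewrite /g ltr_wpDl // mulr_ge0 // mulr_ge0 // ltW.
exists g^-1; first by rewrite invr_gt0.
move=> X XT pX aX X1; have [F XF] := psd_factor XT pX.
have dotX0 : mxdot S0 X0 = 0 by rewrite /mxdot cost_sym costX mxtrace0.
rewrite mxdotBr -/S0 dotX0 subr0 mulrC ler_pdivrMr //.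
have Ff : sqn F <= f.
  rewrite -mxtrace_gram -/(gr F) -XF /f.
  have XX : X = X0 + (X - X0) by rewrite addrC subrK.
  have := sqnD X0 (X - X0); rewrite -XX => h1.
  by have := mxdot_AMGM 1%:M X; have := ler_norm (mxdot 1%:M X); have := sqn_ge0 X; have := sqn_ge0 (1%:M : 'M[R]_n); lra.
have Xc : sqn (X - X0) <= c * sqn (S0 *m X).
  have := hc (X - X0); have := linearB (mklin la) X X0 => /= ->.
  rewrite aX subrr sqn0 add0r [(X - X0)^T]linearB /= XT X0_sym subrr sqn0 addr0.
  by rewrite mulmxBr costX subr0.
have SX : sqn (S0 *m X) <= b * mxdot S0 X * f.
  rewrite {1}XF /gr mulmxA; apply: le_trans (sqnM _ _) _; rewrite sqn_tr.
  apply: ler_pM => //; rewrite ?sqn_ge0 // XF /S0 cost_dot.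
  rewrite /cost mulmxDl -scalemxAl /gr trmxK -(mulmxA (s nu *m V)) -(mulmxA Y^T).
  apply: le_trans (sqnD _ _) _; rewrite sqnZ.
  have := sqnM (s nu *m V) ((s nu *m V)^T *m F); have := sqnM Y^T (Y *m F).
  rewrite sqn_tr /b; set u := sqn (s nu *m V); set v := sqn Y.
  set y := sqn (Y *m F); set x := sqn (_ *m F) => hy hx.
  have y0 : 0 <= K * y by rewrite mulr_ge0 ?sqn_ge0 // ltW.
  have u0 : 0 <= u by exact: sqn_ge0.
  have x0 : 0 <= x by exact: sqn_ge0.
  have v0 : 0 <= K * v by rewrite mulr_ge0 ?sqn_ge0 // ltW.
  have hyK := ler_wpM2l (sqr_ge0 K) hy.
  have := mulr_ge0 u0 y0; have := mulr_ge0 v0 x0; lra.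
apply: le_trans Xc _; apply: le_trans (ler_wpM2l c0 SX) _.
have S0X : 0 <= mxdot S0 X.
  by rewrite XF cost_dot addr_ge0 ?sqn_ge0 // mulr_ge0 ?sqn_ge0 // ltW.
by rewrite /g; lra.
Qed.

(** W = V H + Q with H = L W.  The increment of the Gram matrix depends on H
only through M = H H^T - I, so that working with M and J = Q H^T makes the
estimates invariant under W |-> W O with O orthogonal. *)
Lemma factor_split (W : 'M[R]_(n, p)) (H := L *m W) (Q := W - V *m H)
    (M := gr H - 1%:M) (J := Q *m H^T) :
  [/\ L *m Q = 0, gr Q = (1%:M - V *m L) *m (gr W - gr V) *m (1%:M - V *m L)^T,
      M = L *m (gr W - gr V) *m L^T &
      gr W - gr V = dg V (2^-1 *: V *m M + J) + gr Q].
Proof.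
have LQ : L *m Q = 0 by rewrite /Q mulmxBr mulmxA LV mul1mx subrr.
have PW : Q = (1%:M - V *m L) *m W by rewrite mulmxBl mul1mx -mulmxA.
have PV : (1%:M - V *m L) *m V = 0 by rewrite mulmxBl mul1mx -mulmxA LV mulmx1 subrr.
split=> //.
- by rewrite mulmxBr mulmxBl -!gr_mul -PW PV [gr 0]/gr mul0mx subr0.
- by rewrite mulmxBr mulmxBl -!gr_mul LV [gr 1%:M]/gr trmx1 mulmx1.
have WE : W = V *m H + Q by rewrite /Q addrC subrK.
have MT : M^T = M by rewrite /M linearB /= gr_sym trmx1.
rewrite {1}WE grD addrAC; congr (_ + _).
have -> : dg (V *m H) Q = V *m J^T + J *m V^T.
  by rewrite /J (trmx_mul Q) trmxK /dg (trmx_mul V) !mulmxA.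
have lV : linear (dg V) := dg_linear V.
have -> : dg V (2^-1 *: V *m M + J) = 2^-1 *: dg V (V *m M) + dg V J.
  by rewrite -scalemxAl lV.
have -> : dg V J = V *m J^T + J *m V^T by [].
have -> : 2^-1 *: dg V (V *m M) = V *m M *m V^T.
  rewrite /dg trmx_mul MT mulmxA scalerDr -scalerDl.
  by rewrite (_ : 2^-1 + 2^-1 = 1) ?scale1r //; field.
by rewrite /M mulmxBr mulmxBl mulmx1 gr_mul addrAC.
Qed.

Lemma sqn_trace_bound k (M : 'M[R]_k) q (H : 'M[R]_(k, q)) :
  gr H - 1%:M = M -> sqn M <= 1 -> sqn H <= 2 * sqn (1%:M : 'M[R]_k) + 1.
Proof.
move=> HM M1; rewrite -mxtrace_gram -/(gr H) -[gr H](subrK 1%:M) HM mxdotDr.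
have := mxdot_AMGM 1%:M M; have := ler_norm (mxdot 1%:M M).
by have := sqn_ge0 (1%:M : 'M[R]_k); rewrite /sqn => ? ? ?; move: M1; rewrite /sqn; lra.
Qed.

(** When H H^T is close to I, the factor H^T can be cancelled from Q H^T at the
cost of a constant. *)
Lemma sqn_cancel k (H : 'M[R]_k) l (Q : 'M[R]_(l, k)) :
  sqn (gr H - 1%:M) <= 4^-1 -> sqn Q <= sqn H * (4 * sqn (Q *m H^T)).
Proof.
set M := gr H - 1%:M => M4.
have HE : gr H = 1%:M + M by rewrite addrC subrK.
have Hu : H \in unitmx.
  rewrite -row_free_unit; apply: inj_row_free => u uH.
  have : u + u *m M = 0 by rewrite -{1}(mulmx1 u) -mulmxDr -HE /gr mulmxA uH mul0mx.
  move/eqP; rewrite addr_eq0 => /eqP uM; apply: sqn_le0.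
  by have := sqnM u M; have := sqn_ge0 u; rewrite -(sqnN (u *m M)) -uM; nra.
pose Z := Q *m invmx H.
have QZ : Q = Z *m H by rewrite /Z mulmxKV.
have JZ : Q *m H^T = Z + Z *m M by rewrite QZ -mulmxA -[H *m _]/(gr H) HE mulmxDr mulmx1.
rewrite {1}QZ; apply: le_trans (sqnM _ _) _; rewrite mulrC ler_wpM2l ?sqn_ge0 //.
have ZE : Z = Q *m H^T - Z *m M by rewrite JZ addrK.
have := sqnB (Q *m H^T) (Z *m M); rewrite -ZE; have := sqnM Z M; have := sqn_ge0 Z; nra.
Qed.

(** With W = V H + Q as in [factor_split], the direction dW = V M / 2 + J
satisfies a (dg V dW) = - a (Q Q^T), which is quadratic in Q.  Secancy bounds
dW by this and Y dW, so that Q, M and J are all controlled by Y Q.  Now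
<S0, D> = <(S0 - s nu) Q, Q> >= K |Y Q|^2 - c3 |Q|^2, and K absorbs the
negative term. *)
Lemma growth_at_factor : exists K kappa e, [/\ 0 < K, 0 < kappa, 0 < e &
  forall W : 'M[R]_(n, p), a (gr W) = a (gr V) -> sqn (gr W - gr V) <= e ->
    kappa * sqn (gr W - gr V) <= mxdot (cost K) (gr W - gr V)].
Proof.
pose lY := fun W : 'M[R]_(n, p) => Y *m W.
have lYl : linear lY by move=> c x y; rewrite /lY mulmxDr -scalemxAr.
pose sk := fun W : 'M[R]_(n, p) => L *m W - (L *m W)^T.
have skl : linear sk.
  move=> c x y; rewrite /sk mulmxDr -scalemxAr linearP /= scalerBr opprD.
  by rewrite addrACA.
have [W aW YW skW|c0 c0_ge0 hc0] := lin_inj_bound (a_dg_linear la V) lYl skl.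
  have [G [H WE]] := Y_ker YW; have [T T_skew WT] := secant aW WE.
  move: skW; rewrite /sk WT mulmxA LV mul1mx T_skew opprK => TT.
  have -> : T = 0.
    by apply/matrixP => i j; have /matrixP/(_ i j) := TT; rewrite !mxE; lra.
  by rewrite mulmx0.
have [ca ca_ge0 hca] := lin_bound la.
have [cd cd_ge0 hcd] := lin_bound (dg_linear V).
(* The proof yields |Q|^2 <= c1 |Q|^4 + c2 |Y Q|^2, <s nu Q, Q> <= c3 |Q|^2 and
   |D|^2 <= c4 |Y Q|^2 for D the increment of the Gram matrix; h bounds |H|^2.
   The quartic term is absorbed when |Q|^2 <= d, which the radius enforces
   through |Q|^4 <= cQ |D|^2; the other part of the radius gives |M|^2 <= 1/4. *)
pose P := 1%:M - V *m L.
pose h := 2 * sqn (1%:M : 'M[R]_p) + 1.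
pose c1 := 4 * h * sqn P * c0 * ca.
pose c2 := 4 * h ^+ 2 * sqn P * c0.
pose c3 := sqn (s nu) + 1.
pose c4 := 2 * cd * c0 * (2 * ca * c2 + h) + 4 * c2 + 1.
pose d := (2 * c1 + 1)^-1.
pose cQ := sqn (1%:M : 'M[R]_n) * sqn P ^+ 2 + 1.
have h0 : 0 < h by rewrite /h; have := sqn_ge0 (1%:M : 'M[R]_p); lra.
have P0 := sqn_ge0 P.
have c1_ge0 : 0 <= c1 by rewrite /c1 !mulr_ge0 // ltW.
have c2_ge0 : 0 <= c2 by rewrite /c2 !mulr_ge0 // ltW.
have c3_gt0 : 0 < c3 by rewrite /c3; have := sqn_ge0 (s nu); lra.
have c4_gt0 : 0 < c4.
  have x0 := mulr_ge0 ca_ge0 c2_ge0; have x1 : 0 <= 2 * ca * c2 + h by lra.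
  have := mulr_ge0 (mulr_ge0 cd_ge0 c0_ge0) x1; rewrite /c4; lra.
have d_gt0 : 0 < d by rewrite /d invr_gt0; lra.
have cd1 : d * (2 * c1 + 1) = 1 by rewrite /d mulVf // gt_eqF //; lra.
have d_le1 : d <= 1 by nra.
have cQ_gt0 : 0 < cQ.
  by rewrite /cQ ltr_wpDl // mulr_ge0 ?sqn_ge0 ?sqr_ge0.
have l0 := sqr_ge0 (sqn L).
exists (2 * c2 * c3 + 1), c4^-1, (Num.min (d ^+ 2 / cQ) (4 * (sqn L ^+ 2 + 1))^-1).
split=> [||| W aW].
- by rewrite ltr_wpDl // !mulr_ge0 // ltW.
- by rewrite invr_gt0.
- by rewrite lt_min divr_gt0 ?exprn_gt0 //= invr_gt0; lra.
set D := gr W - gr V; rewrite le_min ler_pdivlMr // => /andP[DQ].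
rewrite -[X in _ <= X]mul1r ler_pdivlMr; last lra.
move=> DL; have [] := factor_split W.
set H := L *m W; set Q := W - V *m H; set M := gr H - 1%:M; set J := Q *m H^T.
rewrite -/D -/P => LQ QE ME DE.
have D0 := sqn_ge0 D; have Q0 := sqn_ge0 Q.
have M4 : sqn M <= 4^-1.
  have : sqn M <= sqn L ^+ 2 * sqn D.
    rewrite ME; apply: le_trans (sqnM _ _) _; rewrite sqn_tr.
    by have := sqnM L D; have := sqn_ge0 L; nra.
  lra.
have Hh : sqn H <= h by apply: sqn_trace_bound (erefl M) _; lra.
have QJ := sqn_cancel Q M4; rewrite -/J in QJ.
have Qd : sqn Q <= d.
  rewrite -(@ler_pXn2r _ 2) ?nnegrE //; last exact: ltW.
  apply: le_trans DQ; rewrite -{1}mxtrace_gram -/(gr Q) QE.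
  apply: le_trans (mxdot_CS _ _) _; rewrite mulrC.
  have : sqn (P *m D *m P^T) <= sqn P ^+ 2 * sqn D.
    apply: le_trans (sqnM _ _) _; rewrite sqn_tr.
    by have := sqnM P D; nra.
  have i0 := sqn_ge0 (1%:M : 'M[R]_n); rewrite /cQ => hP.
  have := ler_wpM2r i0 hP; lra.
pose dW := 2^-1 *: V *m M + J.
have adW : a (dg V dW) = - a (gr Q).
  have := la 1 (dg V dW) (gr Q); rewrite !scale1r -DE.
  by have /= -> := linearB (mklin la) (gr W) (gr V); rewrite aW subrr => /esym/eqP; rewrite addr_eq0 => /eqP.
have YdW : Y *m dW = Y *m Q *m H^T.
  by rewrite /dW mulmxDr -scalemxAl -scalemxAr mulmxA YV mul0mx scaler0 add0r mulmxA.
have MT : M^T = M by rewrite /M [LHS]linearB /= gr_sym trmx1.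
have skdW : sk dW = 0.
  rewrite /sk /dW mulmxDr -scalemxAl -scalemxAr mulmxA LV mul1mx /J mulmxA LQ mul0mx addr0.
  by rewrite [(2^-1 *: M)^T]linearZ /= MT subrr.
have JdW : J = P *m dW.
  rewrite /dW mulmxDr -scalemxAl -scalemxAr mulmxA {1}/P mulmxBl mul1mx -mulmxA LV mulmx1.
  by rewrite subrr mul0mx scaler0 add0r /P mulmxBl mul1mx /J -mulmxA (mulmxA L) LQ mul0mx mulmx0 subr0.
set y := sqn (Y *m Q); have y0 : 0 <= y by exact: sqn_ge0.
have dWb : sqn dW <= c0 * (ca * sqn Q ^+ 2 + h * y).
  apply: le_trans (hc0 dW) _; rewrite ler_wpM2l // skdW sqn0 addr0.
  rewrite adW sqnN /lY YdW lerD //.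
    apply: le_trans (hca _) _; rewrite ler_wpM2l //; exact: sqn_gram.
  apply: le_trans (sqnM _ _) _; rewrite sqn_tr mulrC -/y ler_wpM2r //.
have Qy : sqn Q <= 2 * c2 * y.
  have QQ : sqn Q <= c1 * sqn Q ^+ 2 + c2 * y.
    have JJ : sqn J <= sqn P * sqn dW by rewrite JdW sqnM.
    have HJ := ler_wpM2r (sqn_ge0 J) Hh.
    have h4 : 0 <= 4 * h by lra.
    have := ler_wpM2l h4 JJ; have := ler_wpM2l (mulr_ge0 h4 P0) dWb.
    rewrite /c1 /c2; lra.
  have : c1 * sqn Q ^+ 2 <= c1 * d * sqn Q.
    by rewrite expr2 mulrA ler_wpM2r // ler_wpM2l.
  have : c1 * d <= 2^-1 by lra.
  nra.
have Dy : sqn D <= c4 * y.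
  have Q2 : sqn Q ^+ 2 <= sqn Q by rewrite expr2 ler_piMl //; lra.
  rewrite DE; apply: le_trans (sqnD _ _) _.
  have := hcd dW; have := sqn_gram Q; rewrite -[Q *m Q^T]/(gr Q) => hg hd.
  have q2 : sqn Q ^+ 2 <= 2 * c2 * y by lra.
  have e1 := ler_wpM2l ca_ge0 q2.
  have e2 : sqn dW <= c0 * (2 * ca * c2 + h) * y.
    apply: le_trans dWb _; rewrite -mulrA ler_wpM2l //; lra.
  have := ler_wpM2l cd_ge0 e2; rewrite /c4; lra.
rewrite mulrC ler_pdivrMr // mulrC; apply: le_trans Dy _; rewrite ler_wpM2l //; first exact: ltW.
set K := 2 * c2 * c3 + 1; pose S := cost K - s nu.
have SV : S *m V = 0 by rewrite mulmxBl costV subrr.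
have S_sym : S^T = S by rewrite /S linearB /= cost_sym s_sym.
have aD : a D = 0.
  by have /= -> := linearB (mklin la) (gr W) (gr V); rewrite aW subrr.
have -> : mxdot (cost K) D = mxdot (S *m Q) Q.
  have -> : mxdot (cost K) D = mxdot S D.
    by rewrite /S mxdotBl adj aD mxdot0r subr0.
  have WE : W = V *m H + Q by rewrite /Q addrC subrK.
  have SW : S *m W = S *m Q by rewrite WE mulmxDr mulmxA SV mul0mx add0r.
  rewrite mxdotBr !mxdot_gr SV mxdot0l subr0 SW mxdot_mull S_sym SW.
  by rewrite mxdotC.
have -> : mxdot (S *m Q) Q = sqn ((s nu *m V)^T *m Q) + K * y - mxdot (s nu *m Q) Q.
  by rewrite /S mulmxBl mxdotBl -(mxdot_gr (cost K)) cost_dot.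
have := mxdot_AMGM (s nu *m Q) Q; have := ler_norm (mxdot (s nu *m Q) Q).
have := sqnM (s nu) Q; have := sqn_ge0 ((s nu *m V)^T *m Q) => h1 h2 h3 h4.
have h5 : mxdot (s nu *m Q) Q <= c3 * sqn Q.
  by have := mulr_ge0 (sqn_ge0 (s nu)) Q0; rewrite /c3; lra.
by have := ler_wpM2l (ltW c3_gt0) Qy; rewrite /K; lra.
Qed.

End Growth.
End Construction.

(** * Stability of both minimizers under perturbation of the cost *)

Section Stability.
Variables (R : realType) (n m : nat).
Variables (a : 'M[R]_n -> 'cV[R]_m) (s : 'cV[R]_m -> 'M[R]_n).
Hypotheses (la : linear a) (ls : linear s).
Hypothesis adj : forall l M, mxdot (s l) M = mxdot l (a M).
Hypothesis s_sym : forall l, (s l)^T = s l.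
Variable S0 : 'M[R]_n.
Hypothesis S0_sym : S0^T = S0.

(** If the perturbed cost does not increase along D, the growth kappa |D|^2 of
the unperturbed one is compensated by <S0 - C, D>, and Cauchy-Schwarz bounds
D. *)
Lemma perturbed_growth (C D : 'M[R]_n) kappa : 0 < kappa ->
  kappa * sqn D <= mxdot S0 D -> mxdot C D <= 0 ->
  kappa ^+ 2 * sqn D <= sqn (C - S0).
Proof.
move=> k0 growth CD; have D0 := sqn_ge0 D.
have [D_le0|D_gt0] := leP (sqn D) 0.
  have -> : sqn D = 0 by apply/eqP; rewrite eq_le D_le0.
  by rewrite mulr0 sqn_ge0.
have kD : kappa * sqn D <= mxdot (S0 - C) D by rewrite mxdotBl; lra.
have kD0 : 0 <= kappa * sqn D by rewrite mulr_ge0 // ltW.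
have := le_trans (lerXn2r 2 _ _ kD) (mxdot_CS _ _); rewrite !nnegrE => /(_ kD0 (le_trans kD0 kD)).
rewrite -(sqnN (S0 - C)) opprB exprMn expr2 (expr2 (sqn D)) mulrA.
by rewrite ler_pM2r.
Qed.

(** The minimizer over a compact neighbourhood of V V^T lies in its interior by
[perturbed_growth], hence is a local minimizer on the whole constraint set. *)
Lemma factor_stable p (V : 'M[R]_(n, p)) kappa e : 0 < kappa -> 0 < e ->
  (forall W : 'M[R]_(n, p), a (gr W) = a (gr V) -> regular a W) ->
  (forall W : 'M[R]_(n, p), a (gr W) = a (gr V) -> sqn (gr W - gr V) <= e ->
    kappa * sqn (gr W - gr V) <= mxdot S0 (gr W - gr V)) ->
  forall C : 'M[R]_n, C^T = C -> 4 * sqn (C - S0) <= kappa ^+ 2 * e ->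
  exists W : 'M[R]_(n, p), [/\ a (gr W) = a (gr V),
    kappa ^+ 2 * sqn (gr W - gr V) <= sqn (C - S0) &
    exists2 l, (C - s l) *m W = 0 &
      forall T, a (dg W T) = 0 -> 0 <= mxdot ((C - s l) *m T) T].
Proof.
move=> k0 e0 reg growth C CT CS.
pose g (i : option unit) (W : 'M[R]_(n, p)) : R := if i is Some _ then sqn (a (gr W) - a (gr V))
  else sqn (gr W - gr V) - e.
have cgr : mxcts (fun W : 'M[R]_(n, p) => gr W).
  by apply: mxctsM; [exact: mxcts_id | apply: mxcts_tr; exact: mxcts_id].
have cg i : continuous (g i).
  case: i => [u|] /=.
    have c1 : mxcts (fun W : 'M[R]_(n, p) => a (gr W) - a (gr V)).
      by apply: mxctsD; [exact: mxcts_lin | exact: mxcts_cst].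
    exact: (mxcts_dot c1 c1).
  have c1 : mxcts (fun W : 'M[R]_(n, p) => gr W - gr V).
    by apply: mxctsD => //; exact: mxcts_cst.
  exact: mxcts_sqnB.
have cC : continuous (fun W : 'M[R]_(n, p) => mxdot C (gr W)).
  by apply: mxcts_dot => //; exact: mxcts_cst.
have gV i : g i V <= 0 by case: i => [u|]; rewrite /g subrr sqn0 // sub0r oppr_le0 ltW.
have gP W : (forall i, g i W <= 0) <-> a (gr W) = a (gr V) /\ sqn (gr W - gr V) <= e.
  split=> [h|[aW We] [u|] /=]; last by rewrite /g subr_le0.
    split; last by have := h None; rewrite /g subr_le0.
    by apply/eqP; rewrite -subr_eq0; apply/eqP; apply: sqn_le0; exact: (h (Some tt)).
  by rewrite /g aW subrr sqn0.
pose c := sqn (1%:M : 'M[R]_n) + 2 * sqn (gr V) + 2 * e.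
have [W /gP[aW We] Wmin] : exists2 W, (forall i, g i W <= 0) &
    forall W', (forall i, g i W' <= 0) -> mxdot C (gr W) <= mxdot C (gr W').
  apply: (@mx_attains_min R n p _ g _ c V) => // W /gP[_ We].
  rewrite -mxtrace_gram -/(gr W); have := mxdot_AMGM 1%:M (gr W).
  have := ler_norm (mxdot 1%:M (gr W)); have := sqnD (gr V) (gr W - gr V).
  rewrite addrC subrK /c; have := sqn_ge0 (gr W); have := sqn_ge0 (1%:M : 'M[R]_n); lra.
have k2 : 0 < kappa ^+ 2 by rewrite exprn_gt0.
have Wk : kappa ^+ 2 * sqn (gr W - gr V) <= sqn (C - S0).
  by apply: perturbed_growth => //; [exact: growth | rewrite mxdotBr subr_le0 Wmin].
exists W; split=> //.
(* This leaves room for a neighbourhood of W of squared radius e / 4. *)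
have We4 : 4 * sqn (gr W - gr V) <= e.
  by rewrite -(ler_pM2l k2); lra.
apply: (second_order_conditions la ls adj s_sym CT (reg W aW) (e := e / 4)).
  by rewrite divr_gt0.
move=> W' aW' W'e; apply: Wmin; apply/gP; rewrite aW' aW; split=> //.
have := sqnD (gr W' - gr W) (gr W - gr V); rewrite addrA subrK.
lra.
Qed.

(** Compress M0 to an identity block of size its rank; the same compression of
a nearby matrix is still invertible. *)
Lemma rank_lower_semicontinuous k l (M0 : 'M[R]_(k, l)) : exists2 t, 0 < t &
  forall M : 'M[R]_(k, l), sqn (M - M0) <= t -> (\rank M0 <= \rank M)%N.
Proof.
pose P := pinvmx (col_base M0); pose Q := pinvmx (row_base M0).
have PM0Q : P *m M0 *m Q = 1%:M.
  have -> : P *m M0 = row_base M0.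
    transitivity (P *m (col_base M0 *m row_base M0)); first by rewrite mulmx_base.
    by rewrite mulmxA mulVpmx ?col_base_full // mul1mx.
  by rewrite mulmxVp ?row_base_free.
pose c := sqn P * sqn Q; have c0 : 0 <= c by rewrite mulr_ge0 ?sqn_ge0.
exists (2 * c + 1)^-1; first by rewrite invr_gt0; lra.
move=> M; rewrite -[X in _ <= X]mul1r ler_pdivlMr; last lra.
move=> Mt; pose B := P *m M *m Q.
have Bc : sqn (B - 1%:M) <= 2^-1.
  rewrite -PM0Q /B -mulmxBl -mulmxBr; apply: le_trans (sqnM _ _) _.
  have := ler_wpM2r (sqn_ge0 Q) (sqnM P (M - M0)); have := sqn_ge0 (M - M0).
  by rewrite /c in Mt; lra.
have rB : row_free B.
  apply: inj_row_free => u uB; apply: sqn_le0.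
  have : u *m (B - 1%:M) = - u by rewrite mulmxBr uB mulmx1 sub0r.
  have := sqnM u (B - 1%:M) => + uE; rewrite uE sqnN.
  by have := ler_wpM2l (sqn_ge0 u) Bc; have := sqn_ge0 u; lra.
move: rB; rewrite /row_free => /eqP <-.
by apply: leq_trans (mxrankM_maxl _ _) _; exact: mxrankM_maxr.
Qed.

Section SDP.
Variables (X0 : 'M[R]_n) (kappa : R).
Hypotheses (X0_sym : X0^T = X0) (X0_psd : psdmx X0).
Hypothesis S0X0 : S0 *m X0 = 0.
Hypothesis S0_ker : forall k (D : 'M[R]_(n, k)), S0 *m D = 0 -> exists G, D = X0 *m G.
Hypothesis s_inj : forall l, s l *m X0 = 0 -> l = 0.
Hypothesis extreme : forall D : 'M[R]_n,
  D^T = D -> a D = 0 -> (exists G, D = X0 *m G) -> D = 0.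
Hypothesis kappa_gt0 : 0 < kappa.
Hypothesis growth : forall X : 'M[R]_n,
    X^T = X -> psdmx X -> a X = a X0 -> sqn (X - X0) <= 1 ->
    kappa * sqn (X - X0) <= mxdot S0 (X - X0).

Definition feasible (X : 'M[R]_n) := [/\ X^T = X, psdmx X & a X = a X0].

Lemma feasible_segment X Y t : feasible X -> feasible Y -> 0 <= t <= 1 ->
  feasible ((1 - t) *: X + t *: Y).
Proof.
move=> [XT pX aX] [YT pY aY] /andP[t0 t1]; split.
- by rewrite linearD !linearZ /= XT YT.
- apply/psdmxP => x; rewrite mulmxDl -!scalemxAl mxdotDl !mxdotZl.
  have /psdmxP/(_ x) := pX; have /psdmxP/(_ x) := pY => h1 h2.
  by rewrite addr_ge0 // mulr_ge0 //; lra.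
rewrite addrC la; have /= -> := linearZZ (mklin la) (1 - t) X.
by rewrite aX aY -scalerDl (_ : t + (1 - t) = 1) ?scale1r //; ring.
Qed.

(** Segments issued from an interior point stay in the ball for a while, so
that convexity extends local statements to all feasible points. *)
Lemma segment_in_ball (X Y : 'M[R]_n) : 2 * sqn (X - X0) <= 1 ->
  exists2 t, 0 < t <= 2^-1 & sqn ((1 - t) *: X + t *: Y - X0) <= 1.
Proof.
move=> X1; pose N := sqn (Y - X0); have N0 : 0 <= N := sqn_ge0 _.
pose t := (2 * (N + 1))^-1; have tN : t * (2 * (N + 1)) = 1.
  by rewrite mulVf // gt_eqF //; lra.
have t0 : 0 < t by rewrite invr_gt0; lra.
have t2 : t <= 2^-1 by nra.
exists t; first by rewrite t0.
have -> : (1 - t) *: X + t *: Y - X0 = (1 - t) *: (X - X0) + t *: (Y - X0).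
  by rewrite !scalerBr addrACA -opprD -scalerDl (_ : 1 - t + t = 1) ?scale1r //; ring.
have sqn_convex (P Q : 'M[R]_n) : sqn ((1 - t) *: P + t *: Q) =
    (1 - t) * sqn P + t * sqn Q - t * (1 - t) * sqn (P - Q).
  by rewrite /sqn !mxdotlin (mxdotC Q P); ring.
rewrite sqn_convex -/N; have := sqn_ge0 (X - X0 - (Y - X0)).
have : 0 <= t * (1 - t) by rewrite mulr_ge0 //; lra.
move: (sqn (X - X0 - (Y - X0))) (t * (1 - t)) => u v v0 u0.
have := mulr_ge0 v0 u0.
have t1 : 0 <= 1 - t by lra.
have := ler_wpM2l t1 X1; lra.
Qed.

Lemma sdp_minimizer (C : 'M[R]_n) : 2 * sqn (C - S0) <= kappa ^+ 2 ->
  exists X, [/\ feasible X, kappa ^+ 2 * sqn (X - X0) <= sqn (C - S0) &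
    forall Y, feasible Y -> mxdot C X <= mxdot C Y].
Proof.
move=> CS.
pose g (i : 'cV[R]_n + bool + unit) (X : 'M[R]_n) : R :=
  match i with
  | inl (inl x) => mxdot (- X *m x) x
  | inl (inr true) => sqn (X - X^T)
  | inl (inr false) => sqn (a X - a X0)
  | inr _ => sqn (X - X0) - 1
  end.
have cid := @mxcts_id R n n.
have cst (k l : nat) (M : 'M[R]_(k, l)) : mxcts (fun _ : 'M[R]_n => M) by exact: mxcts_cst.
have cg i : continuous (g i).
  case: i => [[x|[]]|u] /=.
  - by apply: mxcts_dot => //; apply: mxctsM => //; exact: mxctsN.
  - have c1 : mxcts (fun X : 'M[R]_n => X - X^T).
      by apply: mxctsD => //; apply: mxctsN; exact: mxcts_tr.
    exact: (mxcts_dot c1 c1).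
  - have c1 : mxcts (fun X : 'M[R]_n => a X - a X0).
      by apply: mxctsD => //; exact: mxcts_lin.
    exact: (mxcts_dot c1 c1).
  have c1 : mxcts (fun X : 'M[R]_n => X - X0) by exact: mxctsD.
  exact: mxcts_sqnB.
have gP X : (forall i, g i X <= 0) <-> feasible X /\ sqn (X - X0) <= 1.
  split=> [h|[[XT pX aX] X1]].
    split; last by have := h (inr tt); rewrite /g subr_le0.
    split.
    - by have /sqn_le0/eqP := h (inl (inr true)); rewrite subr_eq0 => /eqP.
    - apply/psdmxP => x; have := h (inl (inl x)).
      by rewrite /g mulNmx mxdotNl oppr_le0.
    - by have /sqn_le0/eqP := h (inl (inr false)); rewrite subr_eq0 => /eqP.
  case=> [[x|[]]|u] /=.
  - by rewrite mulNmx mxdotNl oppr_le0; move/psdmxP: pX; apply.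
  - by rewrite XT subrr sqn0.
  - by rewrite aX subrr sqn0.
  - by rewrite subr_le0.
have X0_feas : feasible X0 by [].
have [X /gP[fX X1] Xmin] : exists2 X, (forall i, g i X <= 0) &
    forall Y, (forall i, g i Y <= 0) -> mxdot C X <= mxdot C Y.
  apply: (@mx_attains_min R n n _ g _ (2 * sqn X0 + 2) X0) => //.
  - exact: mxcts_dot.
  - move=> X /gP[_ X1]; have := sqnD X0 (X - X0).
    by rewrite addrC subrK; lra.
  - by apply/gP; rewrite subrr sqn0.
have CX0 : mxdot C (X - X0) <= 0.
  by rewrite mxdotBr subr_le0; apply: Xmin; apply/gP; rewrite subrr sqn0.
have kX : kappa ^+ 2 * sqn (X - X0) <= sqn (C - S0).
  apply: perturbed_growth => //; apply: growth => //; by case: fX.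
have X2 : 2 * sqn (X - X0) <= 1.
  have k2 : 0 < kappa ^+ 2 by rewrite exprn_gt0.
  by rewrite -(ler_pM2l k2); lra.
exists X; split=> // Y fY.
have [t /andP[t0 t1] Yt] := segment_in_ball Y X2.
have := Xmin ((1 - t) *: X + t *: Y).
rewrite mxdotDr !mxdotZr => h.
have : mxdot C X <= (1 - t) * mxdot C X + t * mxdot C Y.
  apply: h; apply/gP; split=> //; apply: feasible_segment => //.
  by rewrite ltW //=; lra.
move=> {}h; rewrite -(ler_pM2l t0); lra.
Qed.

(** A minimizer Z = F F^T of the SDP makes F a minimizer among square factors,
where the first-order condition gives S F = 0 with S = C - s l.  The
multiplier l is small because s l Z = S0 (Z - X0) + (C - S0) Z is small and
l |-> s l Z keeps a lower bound for Z near X0. *)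
Lemma multiplier_near : exists d c, [/\ 0 < d, 0 <= c &
  forall C Z : 'M[R]_n, C^T = C -> feasible Z ->
    (forall Y, feasible Y -> mxdot C Z <= mxdot C Y) ->
    sqn (C - S0) <= d -> kappa ^+ 2 * sqn (Z - X0) <= sqn (C - S0) ->
    exists S, [/\ S^T = S, S *m Z = 0 & sqn (S - S0) <= c * sqn (C - S0)]].
Proof.
have lsX : linear (fun l => s l *m X0).
  by move=> c x y; rewrite ls mulmxDl -scalemxAl.
have [c1 c1_ge0 hc1] := lin_inj_bound1 lsX s_inj.
have [c2 c2_ge0 hc2] := lin_bound ls.
have k2 : 0 < kappa ^+ 2 by rewrite exprn_gt0.
(* ci turns the growth bound into |Z - X0|^2 <= ci |C - S0|^2, and d makes this
   small enough for l |-> s l Z to keep a lower bound. *)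
pose c12 := c1 * c2; have c12_ge0 : 0 <= c12 by rewrite mulr_ge0.
pose ci := (kappa ^+ 2)^-1; have ci_gt0 : 0 < ci by rewrite invr_gt0.
have cik : ci * kappa ^+ 2 = 1 by rewrite mulVf // gt_eqF.
pose d := (4 * c12 * ci + ci + 1)^-1.
have dd : 0 < 4 * c12 * ci + ci + 1.
  by have := mulr_ge0 c12_ge0 (ltW ci_gt0); lra.
pose c := 2 + 8 * c12 * (2 * sqn S0 * ci + 2 * (2 * sqn X0 + 2)).
have S00 := sqn_ge0 S0; have X00 := sqn_ge0 X0.
exists d, c; split=> [||C Z CT fZ Zmin Cd kZ].
- by rewrite invr_gt0.
- have := mulr_ge0 c12_ge0 (mulr_ge0 S00 (ltW ci_gt0)).
  by have := mulr_ge0 c12_ge0 X00; rewrite /c; lra.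
have E0 := sqn_ge0 (C - S0).
have ZE : sqn (Z - X0) <= ci * sqn (C - S0).
  by have := ler_wpM2l (ltW ci_gt0) kZ; rewrite mulrA cik mul1r.
have Ed : (4 * c12 * ci + ci + 1) * sqn (C - S0) <= 1.
  by rewrite mulrC -ler_pdivlMr // mul1r.
have Z1 : sqn (Z - X0) <= 1.
  by have := mulr_ge0 (mulr_ge0 c12_ge0 (ltW ci_gt0)) E0; lra.
have Z4 : 4 * c12 * sqn (Z - X0) <= 1.
  have := ler_wpM2l c12_ge0 ZE; have := mulr_ge0 (ltW ci_gt0) E0; lra.
have Zb : sqn Z <= 2 * sqn X0 + 2.
  by have := sqnD X0 (Z - X0); rewrite addrC subrK; lra.
have s_bound l : sqn l <= 4 * c1 * sqn (s l *m Z).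
  have sl : s l *m X0 = s l *m Z - s l *m (Z - X0) by rewrite -mulmxBr opprB addrC subrK.
  have := hc1 l; rewrite sl => h1.
  have h2 := ler_wpM2l c1_ge0 (sqnB (s l *m Z) (s l *m (Z - X0))).
  have h3 := ler_wpM2l c1_ge0 (le_trans (sqnM (s l) (Z - X0)) (ler_wpM2r (sqn_ge0 _) (hc2 l))).
  have := ler_wpM2r (sqn_ge0 l) Z4; rewrite /c12 => h4; lra.
have [ZT pZ aZ] := fZ; have [F ZF] := psd_factor ZT pZ.
have regF : regular a F.
  apply: (injective_regular la ls adj s_sym) => l slF.
  apply: sqn_le0; have := s_bound l.
  by rewrite ZF /gr mulmxA slF mul0mx sqn0 mulr0.
have [|l SF _] := second_order_conditions la ls adj s_sym CT regF ltr01.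
  move=> W aW _; rewrite -ZF; apply: Zmin; split; [exact: gr_sym | exact: psd_gr |].
  by rewrite aW -ZF.
have SZ : (C - s l) *m Z = 0 by rewrite ZF /gr mulmxA SF mul0mx.
exists (C - s l); split=> //; first by rewrite linearB /= CT s_sym.
have slZ : s l *m Z = S0 *m (Z - X0) + (C - S0) *m Z.
  move: SZ; rewrite mulmxBl => /eqP; rewrite subr_eq0 => /eqP <-.
  by rewrite mulmxBr S0X0 subr0 -mulmxDl addrC subrK.
have slb : sqn (s l *m Z) <= (2 * sqn S0 * ci + 2 * (2 * sqn X0 + 2)) * sqn (C - S0).
  rewrite slZ; apply: le_trans (sqnD _ _) _.
  have h1 := le_trans (sqnM S0 (Z - X0)) (ler_wpM2l S00 ZE).
  have h2 := le_trans (sqnM (C - S0) Z) (ler_wpM2l E0 Zb); lra.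
rewrite addrAC; apply: le_trans (sqnB _ _) _.
have h1 := le_trans (hc2 l) (ler_wpM2l c2_ge0 (s_bound l)).
have h2 := ler_wpM2l c12_ge0 slb.
by rewrite /c /c12 in h2 *; lra.
Qed.

Lemma rank_S0 : (n <= \rank S0 + \rank X0)%N.
Proof.
have [|G kG] := S0_ker (D := (kermx S0)^T).
  by rewrite -{1}S0_sym -trmx_mul mulmx_ker trmx0.
by have := mxrankM_maxl X0 G; rewrite -kG mxrank_tr mxrank_ker leq_subLR.
Qed.

(** Rank: S X = 0 with S near S0 bounds the rank of X by n - rank S0 = rank X0,
and X is near X0.  Uniqueness: if Y is another minimizer, the slack S of a
point Z inside the segment from X to Y also kills X, so that
S0 (X - Z) = (S0 - S) (X - Z), while [S0] is injective on the directions
involved. *)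
Lemma sdp_stable : exists2 d, 0 < d & forall C : 'M[R]_n, C^T = C ->
  sqn (C - S0) <= d -> exists X, [/\ feasible X,
    forall Y, feasible Y -> mxdot C X <= mxdot C Y,
    forall Y, feasible Y -> mxdot C Y <= mxdot C X -> Y = X &
    \rank X = \rank X0].
Proof.
have [d1 [c1 [d1_gt0 c1_ge0 mult]]] := multiplier_near.
have lS : linear (fun D : 'M[R]_n => S0 *m D).
  by move=> c x y; rewrite mulmxDr -scalemxAr.
have lskew : linear (fun D : 'M[R]_n => D - D^T).
  by move=> c x y; rewrite linearP /= scalerBr opprD addrACA.
have [D aD SD DT|c2 c2_ge0 hc2] := lin_inj_bound la lS lskew.
  apply: extreme => //; last exact: S0_ker SD.
  by apply/esym/eqP; rewrite -subr_eq0 DT.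
have [t1 t1_gt0 ht1] := rank_lower_semicontinuous S0.
have [t2 t2_gt0 ht2] := rank_lower_semicontinuous X0.
have k2 : 0 < kappa ^+ 2 by rewrite exprn_gt0.
(* d3 keeps the slack S within the rank radius t1 of S0 and within 1 / (2 c2) of
   it, in squared norm; the last term of the radius puts the minimizer in the
   ball of squared radius 1/2 and within the rank radius t2 of X0. *)
pose d3 := Num.min (2^-1 * (c1 * c2 + 1)^-1) (t1 * (c1 + 1)^-1).
have c12 := mulr_ge0 c1_ge0 c2_ge0.
exists (Num.min (Num.min d1 d3) (kappa ^+ 2 * Num.min 2^-1 t2)).
  by rewrite !(lt_min, mulr_gt0, invr_gt0) //=; lra.
move=> C CT; rewrite !le_min -!andbA => /and4P[Cd1 Cc12 Cc1 Ck].
move: Cc12 Cc1; rewrite !ler_pdivlMr; try lra.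
move=> Cc12 Cc1.
have E0 := sqn_ge0 (C - S0).
have Ck2 : sqn (C - S0) <= kappa ^+ 2 * 2^-1.
  by apply: le_trans Ck _; rewrite ler_pM2l // ge_min lexx.
have Ct2 : sqn (C - S0) <= kappa ^+ 2 * t2.
  by apply: le_trans Ck _; rewrite ler_pM2l // ge_min lexx orbT.
have [|X [fX Xk Xmin]] := sdp_minimizer (C := C); first lra.
exists X; split=> //; last first.
  have [S [_ SX Sc]] := mult C X CT fX Xmin Cd1 Xk.
  have rS : (\rank S0 <= \rank S)%N by apply: ht1; lra.
  have rX : (\rank X0 <= \rank X)%N.
    by apply: ht2; rewrite -(ler_pM2l k2); lra.
  apply/eqP; rewrite eqn_leq rX andbT.
  rewrite -(leq_add2l (\rank S)); apply: leq_trans (mulmx0_rank_max SX) _.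
  by apply: leq_trans rank_S0 _; rewrite leq_add2r.
move=> Y fY CY.
have X2 : 2 * sqn (X - X0) <= 1.
  by rewrite -(ler_pM2l k2); lra.
have [t /andP[t0 t1'] Yt] := segment_in_ball Y X2.
(* X and Y are positive semidefinite with positive weights in Z, so a matrix
   that kills Z kills both. *)
set Z := (1 - t) *: X + t *: Y in Yt.
have fZ : feasible Z by apply: feasible_segment => //; rewrite ltW //=; lra.
have CZ : mxdot C Z = mxdot C X.
  by have := Xmin Y fY; rewrite /Z mxdotDr !mxdotZr => h; have -> : mxdot C Y = mxdot C X by [lra | lra]; ring.
have Zmin Y' : feasible Y' -> mxdot C Z <= mxdot C Y' by rewrite CZ; exact: Xmin.
have Zk : kappa ^+ 2 * sqn (Z - X0) <= sqn (C - S0).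
  apply: perturbed_growth => //; first by apply: growth => //; case: fZ.
  by rewrite mxdotBr subr_le0; apply: Zmin.
have [S [ST SZ Sc]] := mult C Z CT fZ Zmin Cd1 Zk.
have SX : S *m X = 0.
  have [[XT pX _] [YT pY _]] := (fX, fY).
  have [F XF] := psd_factor XT pX; have [G YG] := psd_factor YT pY.
  have : mxdot (gr S) Z = 0.
    rewrite /gr mxdot_mulr trmxK (_ : Z *m S = 0) ?mxdot0r //.
    by case: fZ => ZT _ _; apply: trmx_inj; rewrite trmx_mul ST ZT SZ trmx0.
  rewrite /Z mxdotDr !mxdotZr XF YG !mxdot_gr2 ST => sum0.
  have h1 : 0 <= (1 - t) * sqn (S *m F) by rewrite mulr_ge0 ?sqn_ge0 //; lra.
  have h2 : 0 <= t * sqn (S *m G) by rewrite mulr_ge0 ?sqn_ge0 // ltW.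
  have : S *m F = 0.
    apply: sqn_le0; have t3 : 0 < 1 - t by lra.
    by rewrite -(ler_pM2l t3) mulr0; lra.
  by rewrite /gr mulmxA => ->; rewrite mul0mx.
have XZ : X - Z = 0.
  have [[XT _ aX] [ZT _ aZ]] := (fX, fZ).
  apply: sqn_le0; have := hc2 (X - Z).
  have /= -> := linearB (mklin la) X Z; rewrite aX aZ subrr sqn0 add0r.
  rewrite [(X - Z)^T]linearB /= XT ZT subrr sqn0 addr0.
  have -> : S0 *m (X - Z) = - ((S - S0) *m (X - Z)).
    by rewrite mulmxBl [S *m _]mulmxBr SX SZ subrr sub0r opprK.
  rewrite sqnN => h1; have x0 := sqn_ge0 (X - Z).
  have h2 := ler_wpM2l c2_ge0 (le_trans (sqnM (S - S0) (X - Z)) (ler_wpM2r x0 Sc)).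
  by have := ler_wpM2r x0 Cc12; have := mulr_ge0 E0 x0; lra.
have : t *: (X - Y) = 0.
  rewrite -XZ /Z scalerBl scale1r scalerBr opprD opprB !addrA.
  by rewrite (addrC X) addrK.
by move/eqP; rewrite scaler_eq0 gt_eqF //= subr_eq0 => /eqP.
Qed.

End SDP.
End Stability.

(** * Critical points from multipliers *)

Section RiemannianGeometry.
Variables (R : realType) (n m : nat) (A : {linear symmx R n -> 'cV[R]_m}).

Lemma sym_part_subproof (M : 'M[R]_n) : 2^-1 *: (M + M^T) \is symmetricmx.
Proof. by rewrite symmetricmxE linearZ /= [(_ + _)^T]linearD /= trmxK addrC. Qed.

Definition sym_part (M : 'M[R]_n) : symmx R n := SymMx (sym_part_subproof M).

Lemma symmx_tr (X : symmx R n) : (X : 'M[R]_n)^T = X.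
Proof. by case: X => M /= hM; apply/esym/eqP; rewrite -symmetricmxE. Qed.

(** Extending the constraint map through the symmetric part keeps all later
computations in plain matrices. *)
Definition ext (M : 'M[R]_n) : 'cV[R]_m := A (sym_part M).

Definition adjoint (l : 'cV[R]_m) : 'M[R]_n :=
  \matrix_(i, j) mxdot l (ext (delta_mx i j)).

Lemma ext_linear : linear ext.
Proof.
move=> c x y; rewrite /ext -linearP; congr (A _); apply: val_inj => /=.
by rewrite linearP /= addrACA -[c *: x + _]scalerDr [LHS]scalerDr !scalerA mulrC.
Qed.

Lemma extE (X : symmx R n) (M : 'M[R]_n) : M = X -> ext M = A X.
Proof.
move=> ->; congr (A _); apply: val_inj => /=.
by rewrite symmx_tr scalerDr -scalerDl (_ : 2^-1 + 2^-1 = 1) ?scale1r //; field.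
Qed.

Lemma ext_tr M : ext M^T = ext M.
Proof. by congr (A _); apply: val_inj; rewrite /= trmxK addrC. Qed.

Lemma adjoint_linear : linear adjoint.
Proof.
by move=> c x y; apply/matrixP => i j; rewrite !mxE mxdotDl mxdotZl.
Qed.

Lemma adjointP l M : mxdot (adjoint l) M = mxdot l (ext M).
Proof.
rewrite {2}[M]matrix_sum_delta -[ext _]/(mklin ext_linear _) linear_sum.
rewrite (linear_sum (mxdot l)) mxdotE; apply: eq_bigr => i _.
rewrite linear_sum (linear_sum (mxdot l)); apply: eq_bigr => j _.
by rewrite (linearZZ (mklin ext_linear)) /= mxdotZr mxE mulrC.
Qed.

(** Symmetry of the adjoint is the invariance of [ext] under transposition. *)
Lemma adjoint_sym l : (adjoint l)^T = adjoint l.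
Proof.
by apply/matrixP => i j; rewrite !mxE -ext_tr trmx_delta.
Qed.

Lemma ext_gr p (V : 'M[R]_(n, p)) : ext (gr V) = A (gram V).
Proof. exact: extE. Qed.

Lemma ext_dg p (V W : 'M[R]_(n, p)) : ext (dg V W) = A (dgram V W).
Proof. exact: extE. Qed.

Let a := ext.
Let s := adjoint.
Let la : linear a := ext_linear.
Let ls : linear s := adjoint_linear.
Let adj l M : mxdot (s l) M = mxdot l (a M) := adjointP l M.
Let s_sym l : (s l)^T = s l := adjoint_sym l.

Lemma tangent_spaceE p (V W : 'M[R]_(n, p)) : tangent_space A V W <-> a (dg V W) = 0.
Proof. by rewrite /tangent_space /= -ext_dg. Qed.

Lemma tangentB p (V W W' : 'M[R]_(n, p)) :
  tangent_space A V W -> tangent_space A V W' -> tangent_space A V (W - W').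
Proof.
rewrite !tangent_spaceE => tW tW'.
by have /= -> := linearB (mklin (a_dg_linear la V)) W W'; rewrite tW tW' subrr.
Qed.

(** Gradients and tangential projections are selected by [xget]; a tangent vector
is determined by its inner products with tangent vectors, so that exhibiting
one is enough to compute them. *)
Lemma tangent_uniq p (V G G' : 'M[R]_(n, p)) :
  tangent_space A V G -> tangent_space A V G' ->
  (forall W, tangent_space A V W -> mxdot G W = mxdot G' W) -> G = G'.
Proof.
move=> tG tG' GG'; apply/eqP; rewrite -subr_eq0; apply/eqP; apply: sqn_le0.
by rewrite /sqn {1}mxdotBl GG' ?subrr //; exact: tangentB.
Qed.

Lemma riemannian_gradient_eq p (f : 'M[R]_(n, p) -> R) V G :
  tangent_space A V G -> (forall W, tangent_space A V W -> mxdot G W = 'D_W f V) ->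
  riemannian_gradient A f V = G.
Proof.
move=> tG GD; apply: xget_subset1; first by split.
move=> x y [tx xD] [ty yD]; apply: tangent_uniq tx ty _ => W tW.
by rewrite xD // yD.
Qed.

Lemma tangent_proj_eq p (V Z P : 'M[R]_(n, p)) :
  tangent_space A V P -> (forall W, tangent_space A V W -> mxdot Z W = mxdot P W) ->
  tangent_proj A V Z = P.
Proof.
move=> tP PD; apply: xget_subset1.
  by split=> // W tW; rewrite mxdotBl PD // subrr.
move=> x y [tx xD] [ty yD]; apply: tangent_uniq tx ty _ => W tW.
have := xD W tW; have := yD W tW; rewrite !mxdotBl; lra.
Qed.

Lemma cvg_dnbhs0_le (U : normedModType R) (F : R -> U) (L : U) (c h0 : R) :
  0 <= c -> 0 < h0 -> (forall h, h != 0 -> `|h| <= h0 -> `|F h - L| <= c * `|h|) ->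
  F h @[h --> 0^'] --> L.
Proof.
move=> c0 h00 bound; apply/cvgrPdist_le => e e0.
have d0 : 0 < Num.min h0 (e / (c + 1)).
  by rewrite lt_min h00 divr_gt0 //; lra.
near=> h; rewrite distrC; apply: le_trans (bound h _ _) _.
- by near: h; exact: nbhs_dnbhs_neq.
- near: h; apply: dnbhs0_le => //.
- have : `|h| <= e / (c + 1) by near: h; apply: dnbhs0_le; rewrite divr_gt0 //; lra.
  rewrite ler_pdivlMr; last lra.
  by have := normr_ge0 h; nra.
Unshelve. all: by end_near. Qed.

Lemma dgZ p (V W : 'M[R]_(n, p)) c : dg V (c *: W) = c *: dg V W.
Proof. exact: (linearZZ (mklin (dg_linear V))). Qed.

Lemma derive_factor_cost p (C : symmx R n) (V W : 'M[R]_(n, p)) :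
  'D_W (factor_cost C) V = 2 * mxdot (C *m V) W.
Proof.
have bound (h : R) : h != 0 ->
    h^-1 *: (factor_cost C (h *: W + V) - factor_cost C V) =
    2 * mxdot (C *m V) W + h * mxdot C (gr W).
  move=> h0; have fE X : factor_cost C X = mxdot C (gr X) by [].
  rewrite !fE (addrC (h *: W)) grD grZ dgZ !mxdotDr !mxdotZr dot_dg_sym ?symmx_tr //.
  by rewrite /GRing.scale /=; field.
apply: cvg_lim => //.
apply: (@cvg_dnbhs0_le R^o _ _ `|mxdot C (gr W)| 1) => // h h0 _.
by rewrite /= bound // addrC addKr normrM mulrC.
Qed.

(** Injectivity of the adjoint is an open condition, with uniform bounds. *)
Lemma injective_near p (V W : 'M[R]_(n, p)) :
  (forall l, s l *m V = 0 -> l = 0) ->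
  exists c h0, [/\ 0 <= c, 0 < h0 & forall h : R, h ^+ 2 <= h0 ->
    h ^+ 2 <= 1 /\ forall l, sqn l <= c * sqn (s l *m (h *: W + V))].
Proof.
move=> inj; have [c1 c1_ge0 hc1] := lin_inj_bound1 (adjoint_mul_linear ls V) inj.
have [c2 c2_ge0 hc2] := lin_bound ls.
have c12 := mulr_ge0 (mulr_ge0 c1_ge0 c2_ge0) (sqn_ge0 W).
exists (4 * c1), (4 * (c1 * c2 * sqn W) + 1)^-1; split; first lra.
  by rewrite invr_gt0; lra.
move=> h; rewrite -[X in _ <= X]mul1r ler_pdivlMr; last lra.
move=> hh; have h0 := sqr_ge0 h; have hc := mulr_ge0 h0 c12.
split=> [|l]; first lra.
have sl : s l *m V = s l *m (h *: W + V) - h *: (s l *m W).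
  by rewrite mulmxDr -scalemxAr addrC addKr.
have l0 := sqn_ge0 l; have := hc1 l; rewrite sl => h1.
have h2 := ler_wpM2l c1_ge0 (sqnB (s l *m (h *: W + V)) (h *: (s l *m W))).
rewrite sqnZ in h2.
have h3 := le_trans (sqnM (s l) W) (ler_wpM2r (sqn_ge0 W) (hc2 l)).
have h4 := ler_wpM2l (mulr_ge0 c1_ge0 h0) h3.
have h5 : h ^+ 2 * (4 * (c1 * c2 * sqn W)) <= 1 by lra.
have := ler_wpM2r l0 h5; lra.
Qed.

(** The tangential projection of a fixed Z moves at most linearly with the foot
point.  The difference d of the two multipliers solves
a (dg U (s d U)) = r at the moved point U, where r is a polynomial in h
without constant term; pairing with d bounds d by r. *)
Lemma projection_near p (V W Z : 'M[R]_(n, p)) :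
  (forall l, s l *m V = 0 -> l = 0) ->
  exists P : R -> 'M[R]_(n, p), exists c h0, [/\ 0 <= c, 0 < h0,
    (forall h, h ^+ 2 <= h0 -> tangent_space A (h *: W + V) (P h) /\
      forall T, tangent_space A (h *: W + V) T -> mxdot Z T = mxdot (P h) T) &
    forall h, h ^+ 2 <= h0 -> sqn (P h - P 0) <= c * h ^+ 2].
Proof.
move=> inj; have [c1 [h0 [c1_ge0 h0_gt0 near]]] := injective_near W inj.
have [c2 c2_ge0 hc2] := lin_bound ls.
have [ca ca_ge0 hca] := lin_bound la.
(* A multiplier is chosen for every h, arbitrarily when h^2 exceeds h0. *)
have proj (h : R) : exists l, h ^+ 2 <= h0 ->
    a (dg (h *: W + V) (Z - s l *m (h *: W + V))) = 0.
  have [hh|hh] := leP (h ^+ 2) h0; last by exists 0.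
  have injh l : s l *m (h *: W + V) = 0 -> l = 0.
    move=> sl; apply: sqn_le0; have [_ /(_ l)] := near h hh.
    by rewrite sl sqn0 mulr0.
  by have [l tl] := tangent_projection la ls adj s_sym injh Z; exists l.
pose mu h := projT1 (cid (proj h)).
have muP h : h ^+ 2 <= h0 -> a (dg (h *: W + V) (Z - s (mu h) *m (h *: W + V))) = 0.
  by rewrite /mu; case: cid.
pose P h := Z - s (mu h) *m (h *: W + V).
have h00 : (0 : R) ^+ 2 <= h0 by rewrite expr0n ltW.
pose Q := s (mu 0) *m W.
pose x := dg W (P 0) - dg V Q; pose y := dg W Q.
pose cx := ca * (2 * sqn x + 2 * sqn y).
pose c := 2 * (c2 * (c1 ^+ 2 * cx) * (2 * sqn W + 2 * sqn V)) + 2 * sqn Q.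
have cx0 : 0 <= cx by rewrite mulr_ge0 // addr_ge0 // mulr_ge0 ?sqn_ge0.
exists P, c, h0; split=> // [|h hh|h hh].
- rewrite addr_ge0 // mulr_ge0 ?sqn_ge0 // mulr_ge0 //.
    by rewrite mulr_ge0 // mulr_ge0 ?sqr_ge0.
  by rewrite addr_ge0 // mulr_ge0 ?sqn_ge0.
- rewrite tangent_spaceE; split; first exact: muP.
  move=> T /tangent_spaceE tT; rewrite /P mxdotBl.
  have := adj_dg adj s_sym (mu h) (h *: W + V) T; rewrite tT mxdot0r; lra.
have [h1 hl] := near h hh; have hh0 := sqr_ge0 h.
set U := h *: W + V in hl *.
pose d := mu h - mu 0.
have sd : s d = s (mu h) - s (mu 0) by exact: (linearB (mklin ls)).
have PE : P h - P 0 = - (s d *m U) - h *: Q.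
  have VU : s (mu 0) *m V = s (mu 0) *m U - h *: Q.
    by rewrite /U mulmxDr -scalemxAr addrC addKr.
  rewrite /P -/U scale0r add0r VU opprB addrC subrKA sd mulmxBl opprB.
  by rewrite addrAC.
pose r := a (dg U (P 0 - h *: Q)).
have rE : r = h *: a (x - h *: y).
  have -> : h *: a (x - h *: y) = h *: a (x - h *: y) + a (dg V (P 0)).
    by have := muP 0 h00; rewrite -/(P 0) scale0r add0r => ->; rewrite addr0.
  rewrite -la; congr (a _); rewrite (dgC U) /U dg_linear !(dgC (P 0 - _)).
  have XE : P 0 - h *: Q = (- h) *: Q + P 0 by rewrite scaleNr addrC.
  rewrite XE !dg_linear /x /y; set u := dg V Q; set v := dg W Q; set w := dg W (P 0).
  rewrite scaleNr (addrC _ w) [RHS]addrC (addrC _ (dg V (P 0))) addrCA; congr (_ + _).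
  by rewrite scaleNr -scalerBr [w - u - _]addrAC.
have X0E : P 0 - h *: Q = Z - s (mu 0) *m U.
  rewrite /P scale0r add0r /U mulmxDr -scalemxAr -/Q opprD (addrC (- (h *: Q))).
  by rewrite addrA.
have sdr : 2 * sqn (s d *m U) = mxdot d r.
  have -> : r = a (dg U (s d *m U)).
    have -> : s d *m U = (Z - s (mu 0) *m U) - (Z - s (mu h) *m U).
      by rewrite sd mulmxBl opprB [RHS]addrC subrKA.
    have /= -> := linearB (mklin (a_dg_linear la U)) (Z - s (mu 0) *m U) (Z - s (mu h) *m U).
    by rewrite (muP h hh) subr0 /r X0E.
  by rewrite (adj_dg adj s_sym).
have dr : sqn d <= c1 ^+ 2 * sqn r.
  have := mxdot_AMGM d (c1 *: r); rewrite sqnZ mxdotZr -sdr.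
  have := ler_norm (c1 * (2 * sqn (s d *m U))); have := hl d; have := sqn_ge0 d.
  lra.
have rb : sqn r <= h ^+ 2 * cx.
  rewrite rE sqnZ ler_wpM2l //; apply: le_trans (hca _) _; rewrite ler_wpM2l //.
  apply: le_trans (sqnB _ _) _; rewrite sqnZ.
  by have := ler_wpM2r (sqn_ge0 y) h1; lra.
have sdb : sqn (s d) <= h ^+ 2 * (c2 * (c1 ^+ 2 * cx)).
  apply: le_trans (hc2 d) _; rewrite mulrCA ler_wpM2l //.
  by apply: le_trans dr _; rewrite mulrCA ler_wpM2l ?sqr_ge0.
have Ub : sqn U <= 2 * sqn W + 2 * sqn V.
  apply: le_trans (sqnD _ _) _; rewrite sqnZ.
  by have := ler_wpM2r (sqn_ge0 W) h1; lra.
have sdU := le_trans (sqnM (s d) U) (ler_pM (sqn_ge0 _) (sqn_ge0 _) sdb Ub).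
rewrite PE; apply: le_trans (sqnB _ _) _; rewrite sqnN sqnZ /c; lra.
Qed.

(** The gradient at h W + V is 2 h times the tangential projection of S W
there, and it vanishes at V; so its derivative is twice the projection of S W
at V, whose inner product with W is <S W, W>. *)
Lemma second_order_critical_of_multiplier p (b : 'cV[R]_m) (C : symmx R n)
    (V : 'M[R]_(n, p)) (l : 'cV[R]_m) :
  factor_manifold A b V -> (forall l, s l *m V = 0 -> l = 0) ->
  ((C : 'M[R]_n) - s l) *m V = 0 ->
  (forall T, a (dg V T) = 0 -> 0 <= mxdot (((C : 'M[R]_n) - s l) *m T) T) ->
  second_order_critical A b (factor_cost C) V.
Proof.
move=> bV inj SV psdS; set S := (C : 'M[R]_n) - s l in SV psdS.
have CE (U T : 'M[R]_(n, p)) : tangent_space A U T ->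
    mxdot (C *m U) T = mxdot (S *m U) T.
  move=> /tangent_spaceE tT; rewrite /S mulmxBl mxdotBl.
  have := adj_dg adj s_sym l U T; rewrite tT mxdot0r; lra.
have t0 U : tangent_space A U (0 : 'M[R]_(n, p)).
  by apply/tangent_spaceE; exact: (linear0 (mklin (a_dg_linear la U))).
have grad0 : riemannian_gradient A (factor_cost C) V = 0.
  apply: riemannian_gradient_eq => // W tW.
  by rewrite derive_factor_cost CE // SV !mxdot0l mulr0.
split=> // W tW.
have [P [c [h0 [c_ge0 h0_gt0 PP Pc]]]] := projection_near W (S *m W) inj.
have gradE h : h ^+ 2 <= h0 ->
    riemannian_gradient A (factor_cost C) (h *: W + V) = (2 * h) *: P h.
  move=> /PP[tP PT]; apply: riemannian_gradient_eq => [|T tT].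
    apply/tangent_spaceE; rewrite dgZ; have /tangent_spaceE tP' := tP.
    by have /= -> := linearZZ (mklin la) (2 * h) (dg (h *: W + V) (P h)); rewrite tP' scaler0.
  rewrite derive_factor_cost CE // mulmxDr -scalemxAr SV addr0 !mxdotZl PT //.
  by rewrite mulrA.
have D2 : 'D_W (riemannian_gradient A (factor_cost C)) V = 2 *: P 0.
  apply: cvg_lim => //.
  apply: (@cvg_dnbhs0_le _ _ _ (2 * Num.sqrt c) (Num.min 1 h0)).
  - by rewrite mulr_ge0 ?sqrtr_ge0.
  - by rewrite lt_min ltr01.
  move=> h hn0; rewrite le_min => /andP[h1 hh].
  have hh2 : h ^+ 2 <= h0.
    rewrite -real_normK ?num_real //; apply: le_trans hh.
    by rewrite expr2 ler_piMr.
  rewrite /= gradE // grad0 subr0 scalerA (_ : h^-1 * (2 * h) = 2); last by field.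
  rewrite -scalerBr normrZ ger0_norm // -mulrA ler_pM2l //.
  rewrite -ler_sqr ?nnegrE ?mulr_ge0 ?sqrtr_ge0 // exprMn sqr_sqrtr // real_normK ?num_real //.
  exact: le_trans (norm_sqn _) (Pc h hh2).
have [] := PP 0; first by rewrite expr0n ltW.
rewrite scale0r add0r => tP PT.
have -> : riemannian_hessian A (factor_cost C) V W = 2 *: P 0.
  apply: tangent_proj_eq => [|T tT]; last by rewrite D2.
  apply/tangent_spaceE; rewrite dgZ; have /tangent_spaceE tP' := tP.
  by have /= -> := linearZZ (mklin la) 2 (dg V (P 0)); rewrite tP' scaler0.
rewrite mxdotZr (mxdotC W) -PT // mulr_ge0 //; apply: psdS; exact/tangent_spaceE.
Qed.

End RiemannianGeometry.

(** * Boxes of symmetric matrices: measurability and positive measure *)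

Section BoxMeasure.
Import measurable_realfun.
Variable R : realType.

Local Notation mu := (@lebesgue_measure R).
Local Notation len l u := (Num.max 0 (u - l) : R).
Local Notation ind l u y := (((l <= y <= u)%R : bool)%:R : R).

Lemma measurable_ind (D : set R) (d l u : R) :
  measurable_fun D (EFin \o (fun y => d * ind l u y)%R).
Proof.
apply/measurable_EFinP; apply: measurable_funM => //.
rewrite (_ : (fun y => _) = \1_(`[l, u]%classic)); first exact: measurable_indic.
by apply/funext => y; rewrite indicE mem_setE in_itv.
Qed.

Lemma integral_ind_le (d l u lo hi : R) : 0 <= d ->
  (\int[mu]_(y in `[lo, hi]) (d * ind l u y)%:E <= (d * len l u)%:E)%E.
Proof.
move=> d0; have indE y : ind l u y = \1_(`[l, u]%classic) y.
  by rewrite indicE mem_setE in_itv.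
under eq_integral do rewrite indE EFinM.
rewrite ge0_integralZl //; last by apply/measurable_EFinP; exact: measurable_indic.
rewrite integral_indic // EFinM lee_wpmul2l ?lee_fin //.
apply: (@le_trans _ _ (mu `[l, u]%classic)).
  by apply: le_measure; rewrite ?inE; [exact: measurableI | | exact: subIsetl].
rewrite lebesgue_measure_itv /= lte_fin; case: ltP => h.
  by rewrite -EFinB lee_fin le_max lexx orbT.
by rewrite lee_fin le_max lexx.
Qed.

(** Volumes are subadditive under countable coverings.  The covering hypothesis
is read as an inequality between weighted sums of products of indicator
functions; integrating it in one coordinate replaces one indicator by a
length.  The weights w and c record the coordinates already integrated. *)
Lemma box_cover_volume (J : eqType) (s : seq J) (lo hi : J -> R)
    (L U : nat -> J -> R) (w : R) (c : nat -> R) :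
  uniq s -> (forall j, lo j <= hi j) -> 0 <= w -> (forall k, 0 <= c k) ->
  (forall f : J -> R, (forall j, j \in s -> lo j <= f j <= hi j) ->
    (w%:E <= \sum_(0 <= k <oo) (c k * \prod_(j <- s) ind (L k j) (U k j) (f j))%:E)%E) ->
  ((w * \prod_(j <- s) (hi j - lo j))%:E <=
    \sum_(0 <= k <oo) (c k * \prod_(j <- s) len (L k j) (U k j))%:E)%E.
Proof.
elim: s w c => [|j s IH] w c.
  move=> _ _ _ c0 /(_ lo); rewrite big_nil mulr1 => h; apply: le_trans (h _) _.
    by [].
  by apply: lee_nneseries => [k _ _|k _]; rewrite lee_fin !big_nil mulr1.
move=> /= /andP[js us] lohi w0 c0 cov; rewrite big_cons mulrA.
have len0 l u : 0 <= len l u by rewrite le_max lexx.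
have ind0 l u y : 0 <= ind l u y by rewrite ler0n.
under eq_eseriesr do rewrite big_cons mulrA.
apply: IH => //.
- by rewrite mulr_ge0 // subr_ge0.
- by move=> k; rewrite mulr_ge0.
move=> f fs; pose P k := \prod_(i <- s) ind (L k i) (U k i) (f i).
have P0 k : 0 <= P k by exact: prodr_ge0.
have -> : (w * (hi j - lo j))%:E = (\int[mu]_(y in `[lo j, hi j]) (cst w%:E) y)%E.
  rewrite integral_cst //= lebesgue_measure_itv /= lte_fin; case: ltP => h.
    by rewrite -EFinB EFinM.
  by have -> : hi j = lo j; [apply/eqP; rewrite eq_le h lohi | rewrite subrr mulr0 mule0].
pose g k y : \bar R := (c k * P k * ind (L k j) (U k j) y)%:E.
apply: (@le_trans _ _ (\int[mu]_(y in `[lo j, hi j]) (\sum_(0 <= k <oo) g k y))%E).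
  apply: ge0_le_integral => //.
  - by apply: ge0_emeasurable_sum => [k y _ _|k _]; [rewrite lee_fin !mulr_ge0 | exact: measurable_ind].
  move=> y; rewrite /= in_itv /= => yj.
  apply: le_trans (cov (fun i => if i == j then y else f i) _) _.
    move=> i; rewrite inE; case: eqP => [-> //|_] /= /fs //.
  apply: lee_nneseries => k.
    by move=> _ _; rewrite lee_fin mulr_ge0 // prodr_ge0.
  move=> _; rewrite lee_fin big_cons eqxx mulrCA mulrC le_eqVlt; apply/orP; left; apply/eqP.
  congr (_ * _ * _); apply: eq_big_seq => i si.
  by case: eqP => // ij; move: js; rewrite -ij si.
rewrite integral_nneseries //; last 2 first.
- by move=> k; exact: measurable_ind.
- by move=> k y _; rewrite lee_fin !mulr_ge0.
apply: lee_nneseries => [k _ _|k _].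
  by apply: integral_ge0 => y _; rewrite lee_fin !mulr_ge0.
apply: le_trans (integral_ind_le _ _ _ _ _) _; first by rewrite mulr_ge0.
by rewrite lee_fin mulrAC.
Qed.

End BoxMeasure.

Section SymmetricLebesgue.
Variables (R : realType) (n : nat).
Local Notation leb := (@symmx_lebesgue R n).
Local Notation vol := (@symmx_box_volume R n).
Local Notation box := (@symmx_box R n).

Definition upper (ij : 'I_n * 'I_n) := (ij.1 <= ij.2)%N.

Lemma volE B : vol B = \prod_(ij | upper ij) Num.max 0 (B.2 ij.1 ij.2 - B.1 ij.1 ij.2).
Proof. by rewrite /symmx_box_volume pair_big_dep. Qed.

Lemma vol_ge0 B : 0 <= vol B.
Proof. by rewrite volE; apply: prodr_ge0 => ij _; rewrite le_max lexx. Qed.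

Lemma leb_ge0 E : (0 <= leb E)%E.
Proof.
apply: le_ereal_inf_tmp => _ [B _ <-].
by apply: nneseries_ge0 => k _ _; rewrite lee_fin vol_ge0.
Qed.

Lemma leb_le_cover E (B : nat -> 'M[R]_n * 'M[R]_n) :
  E `<=` \bigcup_k box (B k) -> (leb E <= \sum_(0 <= k <oo) (vol (B k))%:E)%E.
Proof. by move=> EB; apply: ereal_inf_lbound; exists B. Qed.

(** Interleave two coverings. *)
Lemma leb_subadditive E F : (leb (E `|` F) <= leb E + leb F)%E.
Proof.
have [Einf|Efin] := eqVneq (leb E) +oo%E.
  by rewrite Einf addye ?leey // gt_eqF // (lt_le_trans _ (leb_ge0 F)) // ltNyr.
have [Finf|Ffin] := eqVneq (leb F) +oo%E.
  by rewrite Finf addey ?leey // gt_eqF // (lt_le_trans _ (leb_ge0 E)) // ltNyr.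
have fin G : leb G != +oo%E -> leb G \is a fin_num.
  by move=> Gfin; rewrite ge0_fin_numE ?leb_ge0 // ltey.
apply/lee_addgt0Pr => e e0; have e2 : 0 < e / 2 by rewrite divr_gt0.
have [_ [BE EB <-] BEe] := lb_ereal_inf_adherent e2 (fin _ Efin).
have [_ [BF FB <-] BFe] := lb_ereal_inf_adherent e2 (fin _ Ffin).
apply: (@le_trans _ _ (\sum_(0 <= k <oo) (vol (BE k))%:E + \sum_(0 <= k <oo) (vol (BF k))%:E)%E).
  pose B k := if odd k then BF k./2 else BE k./2.
  apply: (le_trans (@leb_le_cover _ B _)).
    move=> M [/EB [k _ Mk]|/FB [k _ Mk]].
      by exists k.*2 => //; rewrite /B odd_double doubleK.
    by exists k.*2.+1 => //; rewrite /B /= odd_double /= uphalf_double.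
  have vB0 G : (0 <= (vol G)%:E)%E by rewrite lee_fin vol_ge0.
  apply: lime_le; first by apply: is_cvg_nneseries => k _ _; exact: vB0.
  apply: nearW => N.
  apply: (@le_trans _ _ (\sum_(0 <= k < N.*2) (vol (B k))%:E)%E).
    rewrite -addnn [leRHS](@big_cat_nat _ _ _ N) //= ?leq_addr //.
    by rewrite leeDl //; apply: sume_ge0.
  have -> : (\sum_(0 <= k < N.*2) (vol (B k))%:E =
    \sum_(0 <= k < N) (vol (BE k))%:E + \sum_(0 <= k < N) (vol (BF k))%:E)%E.
    elim: N => [|N IH]; first by rewrite !big_geq // adde0.
    rewrite doubleS !big_nat_recr //= IH /B /= odd_double doubleK /= uphalf_double.
    by rewrite -!addeA; congr (_ + _)%E; rewrite addeCA.
  by apply: leeD; apply: nneseries_lim_ge => k _ _; exact: vB0.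
have -> : e = e / 2 + e / 2 by field.
by rewrite EFinD addeACA; apply: leeD; exact: ltW.
Qed.

(** The half of Caratheodory's criterion that does not follow from
subadditivity. *)
Definition splits (E : set (symmx R n)) :=
  forall X, (leb (X `&` E) + leb (X `&` ~` E) <= leb X)%E.

Lemma splits_caratheodory E : splits E -> symmx_lebesgue_measurable E.
Proof.
move=> sE X; apply/eqP; rewrite eq_le sE andbT.
by rewrite -{1}(setUIDK X E); exact: leb_subadditive.
Qed.

Lemma le_leb E F : E `<=` F -> (leb E <= leb F)%E.
Proof.
move=> EF; apply: ereal_inf_le_tmp => _ [B FB <-]; exists B => //.
exact: subset_trans FB.
Qed.

Lemma splits_setC E : splits E -> splits (~` E).
Proof. by move=> sE X; rewrite setCK addeC. Qed.

Lemma splits_setI E F : splits E -> splits F -> splits (E `&` F).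
Proof.
move=> sE sF X; apply: le_trans (sE X); apply: le_trans (leeD2r _ (sF _)).
rewrite -addeA setIA leeD2l //.
apply: le_trans (leb_subadditive _ _); apply: le_leb => M /= [XM nEF].
have [EM|nEM] := pselect (E M); last by right.
by left; split=> // FM; apply: nEF.
Qed.

Lemma splits_forall (I : eqType) (s : seq I) (E : I -> set (symmx R n)) :
  splits setT -> (forall i, splits (E i)) -> splits [set M | forall i, i \in s -> E i M].
Proof.
move=> sT sE; elim: s => [|i s IH].
  by rewrite (_ : [set M | _] = setT) //; apply/seteqP; split.
rewrite (_ : [set M | _] = E i `&` [set M | forall j, j \in s -> E j M]).
  exact: splits_setI.
apply/seteqP; split=> M /= h.
  by split=> [|j js]; apply: h; rewrite inE ?eqxx ?js ?orbT.
by case: h => Ei Es j; rewrite inE => /orP[/eqP ->//|]; exact: Es.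
Qed.

Lemma leb_set0 : (0 < n)%N -> leb set0 = 0%E.
Proof.
move=> n0; apply/eqP; rewrite eq_le leb_ge0 andbT.
have vol0 : vol (0, 0) = 0.
  rewrite volE; pose i := Ordinal n0; rewrite (bigD1 (i, i)) /upper //=.
  by rewrite !mxE subrr maxxx mul0r.
apply: (le_trans (@leb_le_cover _ (fun=> (0, 0)) _)) => //.
by rewrite eseries0 // => k _ _; rewrite vol0.
Qed.

Lemma splits_setT : (0 < n)%N -> splits setT.
Proof. by move=> n0 X; rewrite setIT setCT setI0 leb_set0 // adde0. Qed.

Lemma cut_length (l u c : R) :
  Num.max 0 (u - l) = Num.max 0 (Num.min c u - l) + Num.max 0 (u - Num.max c l).
Proof.
have [? | ?] := leP c u; have [? | ?] := leP c l; case: (leP 0 (u - l)) => ?;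
  case: (leP 0 (c - l)) => ?; case: (leP 0 (u - c)) => ?; lra.
Qed.

(** Each box of a covering is cut at height c into two boxes whose volumes add
up.  Points of the hyperplane itself may lie on either side, which allows
both closed and open half-spaces. *)
Lemma splits_halfspace (ij : 'I_n * 'I_n) (c : R) (H : set (symmx R n)) : upper ij ->
  (forall M : symmx R n, H M -> M ij.1 ij.2 <= c) ->
  (forall M : symmx R n, ~ H M -> c <= M ij.1 ij.2) -> splits H.
Proof.
move=> uij Hc nHc X; apply: le_ereal_inf_tmp => _ [B XB <-].
pose upd (D : 'M[R]_n) x := \matrix_(i, j) if (i, j) == ij then x else D i j.
pose B1 k := ((B k).1, upd (B k).2 (Num.min c ((B k).2 ij.1 ij.2))).
pose B2 k := (upd (B k).1 (Num.max c ((B k).1 ij.1 ij.2)), (B k).2).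
have updE D x i j : upd D x i j = if (i, j) == ij then x else D i j by rewrite mxE.
have volB k : vol (B k) = vol (B1 k) + vol (B2 k).
  rewrite !volE !(bigD1 ij uij) /=.
  have e1 : \prod_(kl | upper kl && (kl != ij)) Num.max 0 ((B1 k).2 kl.1 kl.2 - (B1 k).1 kl.1 kl.2) =
    \prod_(kl | upper kl && (kl != ij)) Num.max 0 ((B k).2 kl.1 kl.2 - (B k).1 kl.1 kl.2).
    by apply: eq_bigr => -[i j] /= /andP[_ /negbTE nij]; rewrite updE nij.
  have e2 : \prod_(kl | upper kl && (kl != ij)) Num.max 0 ((B2 k).2 kl.1 kl.2 - (B2 k).1 kl.1 kl.2) =
    \prod_(kl | upper kl && (kl != ij)) Num.max 0 ((B k).2 kl.1 kl.2 - (B k).1 kl.1 kl.2).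
    by apply: eq_bigr => -[i j] /= /andP[_ /negbTE nij]; rewrite updE nij.
  rewrite e1 e2 -mulrDl; congr (_ * _).
  rewrite !updE -surjective_pairing eqxx.
  set l := (B k).1 _ _; set u := (B k).2 _ _.
  exact: cut_length.
have -> : (\sum_(0 <= k <oo) (vol (B k))%:E =
  \sum_(0 <= k <oo) (vol (B1 k))%:E + \sum_(0 <= k <oo) (vol (B2 k))%:E)%E.
  rewrite -nneseriesD; last 2 first.
  - by move=> k _ _; rewrite lee_fin vol_ge0.
  - by move=> k _ _; rewrite lee_fin vol_ge0.
  by apply: eq_eseriesr => k _; rewrite volB EFinD.
apply: leeD; apply: leb_le_cover => M [/XB[k _ Mk] HM]; exists k => // i j ij_le;
  have := Mk i j ij_le; rewrite /= updE; case: eqP => // ijE.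
- by have := Hc M HM; rewrite -ijE /= => h /andP[-> h2]; rewrite le_min h h2.
- by have := nHc M HM; rewrite -ijE /= => h /andP[h2 ->]; rewrite ge_max h h2.
Qed.

(** A box is a finite intersection of half-spaces. *)
Lemma box_measurable B : (0 < n)%N -> symmx_lebesgue_measurable (box B).
Proof.
move=> n0; apply: splits_caratheodory.
pose lower ij := [set M : symmx R n | upper ij -> B.1 ij.1 ij.2 <= M ij.1 ij.2].
pose higher ij := [set M : symmx R n | upper ij -> M ij.1 ij.2 <= B.2 ij.1 ij.2].
have all_splits ij : splits (lower ij `&` higher ij).
  have [uij|nij] := boolP (upper ij); last first.
    rewrite (_ : _ `&` _ = setT); first exact: splits_setT.
    by apply/seteqP; split=> // M _; split=> /(negP nij).
  apply: splits_setI.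
    rewrite -[lower ij]setCK; apply: splits_setC.
    apply: (@splits_halfspace ij (B.1 ij.1 ij.2)) => // M /=.
      by move=> h; rewrite leNgt; apply/negP => h2; apply: h => _; exact: ltW.
    by move/contrapT; exact.
  apply: (@splits_halfspace ij (B.2 ij.1 ij.2)) => // M /=; first exact.
  by move=> h; rewrite leNgt; apply/negP => h2; apply: h => _; exact: ltW.
rewrite (_ : box B = [set M | forall ij, ij \in enum {: 'I_n * 'I_n} ->
    (lower ij `&` higher ij) M]).
  by apply: splits_forall => //; exact: splits_setT.
apply/seteqP; split=> M h.
  by move=> [i j] _; split=> /= uij; have /andP[] := h i j uij.
by move=> i j ij; have [] := h (i, j) (mem_enum _ _) => /(_ ij) /= -> /(_ ij) ->.
Qed.

Lemma symmx_of_upper (f : 'I_n * 'I_n -> R) : exists M : symmx R n,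
  forall ij, upper ij -> M ij.1 ij.2 = f ij.
Proof.
pose M : 'M[R]_n := \matrix_(i, j) if (i <= j)%N then f (i, j) else f (j, i).
have MT : M \is symmetricmx.
  rewrite symmetricmxE; apply/eqP/matrixP => i j; rewrite !mxE.
  by case: ltngtP => // /val_inj ->.
by exists (SymMx MT) => -[i j] /=; rewrite /upper /= mxE => ->.
Qed.

(** Any covering has at least the volume of the box, by [box_cover_volume] over
the coordinates on and above the diagonal. *)
Lemma leb_box_gt0 (B : 'M[R]_n * 'M[R]_n) : (forall i j, B.1 i j < B.2 i j) -> (0 < leb (box B))%E.
Proof.
move=> B12; pose s := [seq ij <- enum {: 'I_n * 'I_n} | upper ij].
pose v := \prod_(ij <- s) (B.2 ij.1 ij.2 - B.1 ij.1 ij.2).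
have v0 : 0 < v by apply: prodr_gt0 => ij _; rewrite subr_gt0.
apply: (@lt_le_trans _ _ v%:E); first by rewrite lte_fin.
apply: le_ereal_inf_tmp => _ [C BC <-].
have := @box_cover_volume R _ s (fun ij => B.1 ij.1 ij.2) (fun ij => B.2 ij.1 ij.2)
  (fun k ij => (C k).1 ij.1 ij.2) (fun k ij => (C k).2 ij.1 ij.2) 1 (fun=> 1).
rewrite mul1r => H; apply: le_trans (H _ _ _ _ _) _ => //.
- by rewrite filter_uniq // enum_uniq.
- by move=> ij; exact: ltW.
- move=> f fs; have [M Mf] := symmx_of_upper f.
  have [|k _ Mk] := BC M.
    move=> i j ij; have := Mf (i, j) ij => /= ->; apply: (fs (i, j)).
    by rewrite mem_filter /upper /= ij mem_enum.
  rewrite (@nneseriesD1 _ _ k xpredT) //; last first.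
    by move=> h _; rewrite lee_fin mul1r prodr_ge0.
  rewrite mul1r big_seq big1.
    by rewrite leeDl // nneseries_ge0 // => h _ _; rewrite lee_fin mul1r prodr_ge0.
  move=> [i j]; rewrite mem_filter => /andP[ij _].
  by have := Mf (i, j) ij => /= <-; rewrite (Mk i j ij).
- rewrite le_eqVlt; apply/orP; left; apply/eqP; apply: eq_eseriesr => k _.
  by rewrite mul1r volE big_filter big_enum_cond.
Qed.

End SymmetricLebesgue.

(** * The bad costs *)

Section Extremality.
Variables (R : realType) (n m : nat) (A : {linear symmx R n -> 'cV[R]_m}) (b : 'cV[R]_m).

(** A direction D with range in that of X0 is X0 Z X0 for some Z, hence is
dominated by X0 as a quadratic form: X0 + t D and X0 - t D are both feasible
for small t, and X0 is their midpoint. *)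
Lemma extreme_point_face (X0 : symmx R n) (D : 'M[R]_n) :
  extreme_point (sdp_feasible A b) X0 ->
  D^T = D -> ext A D = 0 -> (exists G, D = (X0 : 'M[R]_n) *m G) -> D = 0.
Proof.
move=> [[AX0 pX0] X0_ext] DT aD [G DG]; set X := (X0 : 'M[R]_n) in DG pX0.
have XT : X^T = X := symmx_tr X0.
have [U XU] := psd_factor XT pX0.
pose Z := G *m pinvmx X.
have DGX : D = G^T *m X by rewrite -DT DG trmx_mul XT.
have XpX : X *m pinvmx X *m X = X by rewrite mulmxKpV.
have DpX : D *m pinvmx X *m X = D by rewrite {1}DGX -(mulmxA G^T X) -(mulmxA G^T) XpX -DGX.
have DZ : D = X *m Z *m X by rewrite /Z mulmxA -DG DpX.
pose c := (sqn Z + 1) * sqn U; have c0 : 0 <= c.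
  by rewrite mulr_ge0 ?sqn_ge0 // addr_ge0 ?sqn_ge0.
have bound (x : 'cV[R]_n) : `|mxdot (D *m x) x| <= c * mxdot (X *m x) x.
  have -> : mxdot (D *m x) x = mxdot (Z *m (X *m x)) (X *m x).
    by rewrite DZ -!mulmxA mxdot_mull XT.
  have Xx : sqn (X *m x) <= sqn U * mxdot (X *m x) x.
    rewrite {1 2}XU /gr -mulmxA (mxdot_mull U); exact: sqnM.
  have := mxdot_AMGM (Z *m (X *m x)) (X *m x); have := sqnM Z (X *m x).
  have z1 : 0 <= sqn Z + 1 by rewrite addr_ge0 ?sqn_ge0.
  have := ler_wpM2l z1 Xx; have := normr_ge0 (mxdot (Z *m (X *m x)) (X *m x)); rewrite /c; lra.
have Dsym : D \is symmetricmx by rewrite symmetricmxE DT.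
pose Ds : symmx R n := SymMx Dsym.
have ADs : A Ds = 0 by rewrite -(@extE _ _ _ A Ds D).
pose t := (c + 1)^-1; have t0 : 0 < t by rewrite invr_gt0; lra.
have tc : t * (c + 1) = 1 by rewrite mulVf // gt_eqF //; lra.
have psd_pm (u : R) : `|u| <= t -> sdp_feasible A b (X0 + u *: Ds).
  move=> ut; split; first by rewrite linearD linearZ /= ADs scaler0 addr0.
  apply/psdmxP => x /=; rewrite mulmxDl -scalemxAl mxdotDl mxdotZl.
  have X_ge0 : 0 <= mxdot (X *m x) x by move/psdmxP: pX0; apply.
  have : `|u * mxdot (D *m x) x| <= t * (c * mxdot (X *m x) x).
    by rewrite normrM ler_pM.
  rewrite ler_norml => /andP[h _]; rewrite -/X.
  have := mulr_ge0 (ltW t0) X_ge0; nra.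
have tt : `|t| <= t by rewrite ger0_norm // ltW.
have half0 : (0 : R) < 2^-1 by lra.
have half1 : 2^-1 < 1 :> R by lra.
have ptD := psd_pm t tt.
have pntD : sdp_feasible A b (X0 + (- t) *: Ds) by apply: psd_pm; rewrite normrN.
have [|XtD _] := X0_ext _ _ _ ptD pntD half0 half1.
  rewrite !scalerDr addrACA -scalerDl (_ : 2^-1 + (1 - 2^-1) = 1) ?scale1r; last by field.
  rewrite (_ : 1 - 2^-1 = 2^-1); last by field.
  by rewrite scaleNr scalerN subrr addr0.
move: XtD => /(congr1 (fun M : symmx R n => M - X0)); rewrite addrC addKr subrr.
by move=> /eqP; rewrite scaler_eq0 gt_eqF //= => /eqP/(congr1 (@symmx_val R n)).
Qed.

End Extremality.

Theorem theorem2 (R : realType) (n m r p : nat)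
  (n_gt0 : (0 < n)%N) (m_gt0 : (0 < m)%N) (r_gt0 : (0 < r)%N) (p_gt0 : (0 < p)%N)
  (le_rp : (r <= p)%N) (le_pm : ((p * p.+1)./2 + p * r <= m)%N)
  (A : {linear symmx R n -> 'cV[R]_m}) (b : 'cV[R]_m)
  (X0 : symmx R n)
  (X0_extreme : extreme_point (sdp_feasible A b) X0)
  (X0_rank : \rank X0 = r)
  (Ab_regular : p_regular A b p)
  (V_secant : exists V : 'M[R]_(n, p),
     factor_manifold A b V /\ minimally_secant A X0 V) :
  exists E_bad : set (symmx R n),
    [/\ symmx_lebesgue_measurable E_bad,
        symmx_lebesgue E_bad <> 0%E
      & forall C : symmx R n, E_bad C ->
          (exists X : symmx R n,
             [/\ global_minimizer (sdp_feasible A b) (sdp_cost C) X,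
                 forall Y : symmx R n,
                   global_minimizer (sdp_feasible A b) (sdp_cost C) Y -> Y = X
               & \rank X = r]) /\
          (exists V : 'M[R]_(n, p),
             second_order_critical A b (factor_cost C) V /\
             ~ global_minimizer (@factor_manifold R n m A b p)
                 (factor_cost C) V)].
Proof.
have [V [bV [rankV capV secV]]] := V_secant.
pose a := ext A; pose s := adjoint A.
have la : linear a := @ext_linear R n m A.
have ls : linear s := @adjoint_linear R n m A.
have adj l M : mxdot (s l) M = mxdot l (a M) := adjointP A l M.
have s_sym l : (s l)^T = s l := adjoint_sym A l.
pose X : 'M[R]_n := X0.
have XT : X^T = X := symmx_tr X0.
have [[AX0 pX] _] := X0_extreme.
have aX : a X = b by rewrite /a (extE A (X := X0)).
have agr (W : 'M[R]_(n, p)) : a (gr W) = A (gram W) := ext_gr A W.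
have aV : a (gr V) = b by rewrite agr.
have regA (W : 'M[R]_(n, p)) : a (gr W) = a (gr V) -> regular a W.
  rewrite agr aV => /Ab_regular reg y; have [T AT] := reg y.
  by exists T; rewrite /a ext_dg.
pose L := pinvmx V.
have LV : L *m V = 1%:M by rewrite mulVpmx // /row_full rankV.
have transversal k (G : 'M[R]_(n, k)) H : X *m G = V *m H -> X *m G = 0.
  move=> XG; apply: trmx_inj; rewrite trmx0; apply/eqP; rewrite -submx0 -capV sub_capmx.
  by rewrite {1}trmx_mul submxMl XG trmx_mul submxMl.
have secant (W : 'M[R]_(n, p)) G H : a (dg V W) = 0 -> W = X *m G + V *m H ->
    exists2 T : 'M[R]_p, T^T = - T & W = V *m T.
  move=> aW WE; have [||T Tskew WT] := secV W.
  - exact/tangent_spaceE.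
  - by rewrite WE linearD /= !trmx_mul addmx_sub_adds // submxMl.
  exists T => //; move: Tskew; rewrite is_hermitianmxE expr1 map_mx_id // scaleN1r => /eqP TE.
  by rewrite {2}TE opprK.
have [nu [nuV nuX]] := dual_certificate la ls adj s_sym XT LV transversal secant.
have [Y [YX YV Y_ker]] := annihilator X V.
have [K [k1 [e [K0 k1_gt0 e_gt0 growV]]]] :=
  growth_at_factor la adj s_sym LV secant YV Y_ker nuV.
have face D : D^T = D -> a D = 0 -> (exists G, D = X *m G) -> D = 0.
  exact: extreme_point_face X0_extreme.
have [k2 k2_gt0 growX] :=
  growth_at_extreme_point la s_sym XT YX Y_ker nuV nuX K0 face.
set S0 := cost s V Y nu K in growV growX.
have S0T : S0^T = S0 := cost_sym s V Y nu K.
have S0X : S0 *m X = 0 := costX s_sym YX nuX K.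
have S0_ker k (D : 'M[R]_(n, k)) : S0 *m D = 0 -> exists G, D = X *m G.
  exact: (cost_kernel s_sym Y_ker nuV nuX K0).
have [U0 XU0] : exists U0 : 'M[R]_(n, p), X = gr U0.
  by apply: psd_low_rank => //; rewrite X0_rank.
have bU0 : a (gr U0) = b by rewrite -XU0.
have s_inj l : s l *m X = 0 -> l = 0.
  move=> sX; apply: (regular_adjoint_inj adj s_sym (regA U0 _)); first by rewrite bU0 aV.
  by apply: sqn_le0; rewrite /sqn mxdot_mulr -mulmxA -[U0 *m _]/(gr U0) -XU0 sX mxdot0r.
have [d d_gt0 stab] := sdp_stable la ls adj s_sym S0T XT pX S0X S0_ker s_inj face k2_gt0 growX.
(* <S0, V V^T> = |V^T N V|^2 = p. *)
have gap : 1 <= mxdot S0 (gr V).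
  rewrite cost_dot YV sqn0 mulr0 addr0 trmx_mul s_sym nuV.
  by have := sqn_coord (1%:M : 'M[R]_p) (Ordinal p_gt0) (Ordinal p_gt0); rewrite mxE eqxx expr1n.
(* z bounds |W W^T - X0|^2, so the perturbation costs at most half of the gap. *)
pose z := 2 * sqn (gr V - X) + 2 * e + 1.
have z0 : 0 < z by rewrite /z; have := sqn_ge0 (gr V - X); lra.
have k12 : 0 < k1 ^+ 2 by rewrite exprn_gt0.
pose del := Num.min d (Num.min (k1 ^+ 2 * e / 4) (4 * z)^-1).
have del0 : 0 < del by rewrite !lt_min d_gt0 !divr_gt0 ?mulr_gt0 //= invr_gt0 mulr_gt0.
have bad (C : symmx R n) : sqn ((C : 'M[R]_n) - S0) <= del ->
    (exists X1 : symmx R n,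
       [/\ global_minimizer (sdp_feasible A b) (sdp_cost C) X1,
           forall Y1 : symmx R n,
             global_minimizer (sdp_feasible A b) (sdp_cost C) Y1 -> Y1 = X1
         & \rank X1 = r]) /\
    (exists V1 : 'M[R]_(n, p),
       second_order_critical A b (factor_cost C) V1 /\
       ~ global_minimizer (@factor_manifold R n m A b p) (factor_cost C) V1).
  rewrite !le_min => /and3P[Cd Ce Cz]; have CT := symmx_tr C.
  have feasE (M : symmx R n) : feasible a X M <-> sdp_feasible A b M.
    split=> [[_ pM aM]|[AM pM]]; first by split=> //; rewrite -aX -aM /a (extE A (X := M)).
    by split=> //; [exact: symmx_tr | rewrite aX /a (extE A (X := M))].
  split.
    have [M [fM Mmin Muniq Mr]] := stab C CT Cd.
    have MT : M \is symmetricmx by case: fM => MT _ _; rewrite symmetricmxE MT.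
    exists (SymMx MT); split=> //; last by rewrite Mr.
      split; first exact/feasE.
      by move=> N /feasE fN; exact: Mmin.
    move=> N [/feasE fN Nmin]; apply: val_inj; apply: Muniq => //.
    by apply: (Nmin (SymMx MT)); exact/feasE.
  have [|W [aW Wk [l SW psdW]]] := factor_stable la ls adj s_sym k1_gt0 e_gt0 regA growV CT.
    by move: Ce; rewrite ler_pdivlMr // mulrC.
  have bW : factor_manifold A b W by rewrite /factor_manifold /= -agr aW.
  exists W; split.
    by apply: (second_order_critical_of_multiplier bW _ SW psdW) => l' /(regular_adjoint_inj adj s_sym (regA W aW)).
  move=> [_ /(_ U0)]; rewrite /factor_manifold /= -agr bU0 => /(_ erefl).
  rewrite -[factor_cost C W]/(mxdot C (gr W)) -[factor_cost C U0]/(mxdot C (gr U0)) -XU0.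
  have We : sqn (gr W - gr V) <= e.
    rewrite -(ler_pM2l k12); apply: le_trans Wk _; apply: le_trans Ce _.
    have := mulr_gt0 k12 e_gt0; lra.
  have grow0 : 0 <= mxdot S0 (gr W - gr V).
    by apply: le_trans (growV W aW We); rewrite mulr_ge0 ?sqn_ge0 // ltW.
  have Zz : sqn (gr W - X) <= z.
    have := sqnD (gr V - X) (gr W - gr V); rewrite addrC addrA subrK /z; lra.
  have : `|mxdot ((C : 'M[R]_n) - S0) (gr W - X)| <= 2^-1.
    apply: mxdot_le => //; apply: le_trans (ler_pM _ _ Cz Zz) _; rewrite ?sqn_ge0 //.
    by rewrite le_eqVlt; apply/orP; left; apply/eqP; field; rewrite gt_eqF.
  have S0dX : mxdot S0 X = 0 by rewrite /mxdot S0T S0X mxtrace0.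
  rewrite ler_norml => /andP[]; rewrite mxdotBl !(mxdotBr C) (mxdotBr S0 _ X) S0dX.
  by move: grow0; rewrite mxdotBr; lra.
(* On the box |C - S0|^2 <= n^2 h^2 <= n^2 h <= del. *)
pose h := Num.min 1 (del / ((n * n)%:R + 1)).
have nn0 : 0 <= (n * n)%:R :> R by [].
have h0 : 0 < h by rewrite lt_min ltr01 divr_gt0 //; lra.
pose B : 'M[R]_n * 'M[R]_n := (S0 - const_mx h, S0 + const_mx h).
exists (symmx_box B); split.
- exact: box_measurable.
- by apply/eqP; rewrite gt_eqF //; apply: leb_box_gt0 => i j; rewrite !mxE; lra.
move=> C CB; apply: bad; apply: le_trans (sqn_norm _) _.
have Ch : `|(C : 'M[R]_n) - S0| <= h.
  apply: mx_norm_le => [|i j]; first exact: ltW.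
  have upper_coord (i' j' : 'I_n) : (i' <= j')%N -> `|((C : 'M[R]_n) - S0) i' j'| <= h.
    by move=> ij; have := CB i' j' ij; rewrite !mxE ler_norml => /andP[? ?]; apply/andP; split; lra.
  have [ij|ij] := leqP i j; first exact: upper_coord.
  have <- : ((C : 'M[R]_n) - S0)^T = (C : 'M[R]_n) - S0 by rewrite linearB /= symmx_tr S0T.
  by rewrite mxE; apply: upper_coord; exact: ltnW.
have h1 : h <= 1 by rewrite ge_min lexx.
have hd : h * ((n * n)%:R + 1) <= del by rewrite -ler_pdivlMr ?ge_min ?lexx ?orbT //; lra.
have Ch2 : `|(C : 'M[R]_n) - S0| ^+ 2 <= h.
  by have := normr_ge0 ((C : 'M[R]_n) - S0); nra.
by have := ler_wpM2l nn0 Ch2; lra.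
Qed.
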